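(* Let $\mathfrak{g}=\mathfrak{gl}_N$ or $\mathfrak{sl}_N$ (with $N\geq 2$) or $\mathfrak{g}=\mathfrak{sp}_N$ (with $N=2n$, $n\geq 1$), over $\mathbb{C}$, and let $V$ be any non-zero irreducible $\mathfrak{g}$-module (it need not be a weight module). Then the following are equivalent. (1) $x^2-\mathrm{tr}(x)\,x\in \mathrm{Ann}_{\mathrm{U}(\mathfrak{g})}V$ for all $x\in\mathcal{R}_1(\mathfrak{g})$. (2) $V$ is the trivial representation or a fundamental representation of $\mathfrak{g}$.
   Context: All vector spaces and algebras are over $\mathbb{C}$. $\mathbb{C}^N$ is the space of column vectors and $(u|v)=u^Tv$. For $N=2n$ and $w\in\mathbb{C}^N$ put $\overline{w}=(w_{n+1},\ldots,w_{2n},-w_1,\ldots,-w_n)$. Let $J=\begin{pmatrix}0&\mathrm{Id}_n\\-\mathrm{Id}_n&0\end{pmatrix}$ and $\mathfrak{sp}_N=\{A\in\mathfrak{gl}_N : A^TJ+JA=0\}$. Rank-one elements: $\mathcal{R}_1(\mathfrak{gl}_N)=\{ru^T\neq 0 : r,u\in\mathbb{C}^N\}$; $\mathcal{R}_1(\mathfrak{sl}_N)=\{ru^T\neq 0 : r,u\in\mathbb{C}^N,\ (u|r)=0\}$; $\mathcal{R}_1(\mathfrak{sp}_N)=\{u\overline{u}^T\neq0 : u\in\mathbb{C}^N\}$. Here $\mathrm{tr}(x)$ is the usual matrix trace of $x$, $x^2$ is the square in the universal enveloping algebra $\mathrm{U}(\mathfrak{g})$, and $\mathrm{Ann}_{\mathrm{U}(\mathfrak{g})}V=\{u\in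 \mathrm{U}(\mathfrak{g}) : uv=0\ \forall v\in V\}$. Fundamental representations: for $\mathfrak{sl}_N$ and for $\mathfrak{gl}_N$, these are the exterior powers $\Lambda^p\mathbb{C}^N$ of the natural representation with $1\leq p<N$ (for $\mathfrak{gl}_N$, the identity matrix acts on $\Lambda^p\mathbb{C}^N$ by the scalar $p$). For $\mathfrak{sp}_N$, $N=2n$, they are $V(\omega_1)=\mathbb{C}^N$ and, for $2\leq p\leq n$, $V(\omega_p)=\mathrm{Ker}\,\theta_p\subseteq\Lambda^p\mathbb{C}^N$, where $\theta_p:\Lambda^p\mathbb{C}^N\to\Lambda^{p-2}\mathbb{C}^N$, $\theta_p(v_1\wedge\cdots\wedge v_p)=\sum_{i<j}(-1)^{i+j-1}(\overline{v_i}|v_j)\,v_1\wedge\cdots\widehat{v_i}\cdots\widehat{v_j}\cdots\wedge v_p$ (a hat means that the factor is omitted).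
   Formalization: For gl_N, condition (2) also allows the determinant representation Λ^N C^N (x acts by tr x): it is irreducible and satisfies (1), but is neither trivial nor fundamental (1≤p<N), so the equivalence as stated fails for it. The sl_N and sp_N cases are unchanged. *)

(* Defs.v *)
From HB Require Import structures.
From mathcomp Require Import all_boot all_order all_algebra perm generic_quotient.
From mathcomp Require Import boolp classical_sets reals complex.
From mathcomp Require Import zify ring.

Set Implicit Arguments.
Unset Strict Implicit.
Unset Printing Implicit Defensive.

Import GRing.Theory.
Local Open Scope ring_scope.
Local Open Scope quotient_scope.

HB.mixin Record Lmodule_isLie (K : fieldType) L of GRing.Lmodule K L := {
  lie : L -> L -> L;
  lie_linearl : forall a x y z, lie (a *: x + y) z = a *: lie x z + lie y z;
  lie_linearr : forall a x y z, lie x (a *: y + z) = a *: lie x y + lie x z;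
  liexx : forall x, lie x x = 0;
  lie_jacobi : forall x y z,
    lie x (lie y z) + lie y (lie z x) + lie z (lie x y) = 0
}.

#[short(type="lieAlgType")]
HB.structure Definition LieAlgebra (K : fieldType) :=
  {L of GRing.Lmodule K L & Lmodule_isLie K L}.

Record rep (K : fieldType) (L : lieAlgType K) (V : lmodType K) := Rep {
  rep_fun :> L -> V -> V;
  rep_linearl : forall a x y v,
    rep_fun (a *: x + y) v = a *: rep_fun x v + rep_fun y v;
  rep_linearr : forall x a u v,
    rep_fun x (a *: u + v) = a *: rep_fun x u + rep_fun x v;
  rep_lie : forall x y v,
    rep_fun (lie x y) v = rep_fun x (rep_fun y v) - rep_fun y (rep_fun x v)
}.

Definition submodule (K : fieldType) (L : lieAlgType K) (V : lmodType K)
    (rho : rep L V) (W : set V) : Prop :=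
  [/\ W 0, (forall a u v, W u -> W v -> W (a *: u + v)) &
      forall x v, W v -> W (rho x v)].

Definition irreducible_rep (K : fieldType) (L : lieAlgType K) (V : lmodType K)
    (rho : rep L V) : Prop :=
  (exists v : V, v != 0) /\
  forall W : set V, submodule rho W -> W = [set 0]%classic \/ W = setT.

Definition rep_iso (K : fieldType) (L : lieAlgType K) (V W : lmodType K)
    (rho : rep L V) (sigma : rep L W) : Prop :=
  exists2 f : {linear V -> W}, bijective f &
    forall x v, f (rho x v) = sigma x (f v).

Section Enveloping.
Variables (K : fieldType) (L : lieAlgType K).

Inductive uterm : Type :=
| TGen of L
| TZero
| TOne
| TAdd of uterm & uterm
| TMul of uterm & uterm
| TScale of K & uterm.

(* U(L) is the quotient of uterm by ueq, the least congruence that makes it an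
   associative unital K-algebra in which TGen is linear and turns the Lie
   bracket into the commutator. *)
Inductive ueq : uterm -> uterm -> Prop :=
| ueq_refl t : ueq t t
| ueq_sym s t : ueq s t -> ueq t s
| ueq_trans s t u : ueq s t -> ueq t u -> ueq s u
| ueq_add s s' t t' : ueq s s' -> ueq t t' -> ueq (TAdd s t) (TAdd s' t')
| ueq_mul s s' t t' : ueq s s' -> ueq t t' -> ueq (TMul s t) (TMul s' t')
| ueq_scale a t t' : ueq t t' -> ueq (TScale a t) (TScale a t')
| ueq_addA s t u : ueq (TAdd s (TAdd t u)) (TAdd (TAdd s t) u)
| ueq_addC s t : ueq (TAdd s t) (TAdd t s)
| ueq_add0 t : ueq (TAdd TZero t) t
| ueq_addN t : ueq (TAdd (TScale (-1) t) t) TZero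
| ueq_scaleA a b t : ueq (TScale a (TScale b t)) (TScale (a * b) t)
| ueq_scale1 t : ueq (TScale 1 t) t
| ueq_scaleDr a s t :
    ueq (TScale a (TAdd s t)) (TAdd (TScale a s) (TScale a t))
| ueq_scaleDl a b t :
    ueq (TScale (a + b) t) (TAdd (TScale a t) (TScale b t))
| ueq_mulA s t u : ueq (TMul s (TMul t u)) (TMul (TMul s t) u)
| ueq_mul1 t : ueq (TMul TOne t) t
| ueq_mulr1 t : ueq (TMul t TOne) t
| ueq_mulDl s t u : ueq (TMul (TAdd s t) u) (TAdd (TMul s u) (TMul t u))
| ueq_mulDr s t u : ueq (TMul s (TAdd t u)) (TAdd (TMul s t) (TMul s u))
| ueq_scaleAl a s t : ueq (TScale a (TMul s t)) (TMul (TScale a s) t)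
| ueq_scaleAr a s t : ueq (TScale a (TMul s t)) (TMul s (TScale a t))
| ueq_gen_linear a x y :
    ueq (TGen (a *: x + y)) (TAdd (TScale a (TGen x)) (TGen y))
| ueq_gen_lie x y :
    ueq (TGen (lie x y))
        (TAdd (TMul (TGen x) (TGen y)) (TScale (-1) (TMul (TGen y) (TGen x)))).

HB.instance Definition _ := gen_eqMixin uterm.
HB.instance Definition _ := gen_choiceMixin uterm.

Definition ueqb (s t : uterm) : bool := `[< ueq s t >].

Lemma ueqb_refl : reflexive ueqb.
Proof. by move=> t; apply/asboolP; exact: ueq_refl. Qed.

Lemma ueqb_sym : symmetric ueqb.
Proof.
by move=> s t; apply/asboolP/asboolP => h; exact: ueq_sym.
Qed.

Lemma ueqb_trans : transitive ueqb.
Proof.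
move=> t s u /asboolP h1 /asboolP h2; apply/asboolP; exact: ueq_trans h1 h2.
Qed.

Canonical ueq_equiv := EquivRel ueqb ueqb_refl ueqb_sym ueqb_trans.

Definition Uea := {eq_quot ueq_equiv}.
HB.instance Definition _ := Choice.on Uea.
HB.instance Definition _ := Quotient.on Uea.

Lemma ueaP (s t : uterm) : \pi_Uea s = \pi_Uea t <-> ueq s t.
Proof.
by split=> [/eqmodP/asboolP | h]; last by apply/eqmodP/asboolP.
Qed.

Lemma ueq_repr (t : uterm) : ueq (repr (\pi_Uea t)) t.
Proof. by apply/ueaP; rewrite reprK. Qed.

Definition uea_zero : Uea := \pi_Uea TZero.
Definition uea_one : Uea := \pi_Uea TOne.
Definition uea_add : Uea -> Uea -> Uea := lift_op2 Uea TAdd.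
Definition uea_mul : Uea -> Uea -> Uea := lift_op2 Uea TMul.
Definition uea_scale (c : K) : Uea -> Uea := lift_op1 Uea (TScale c).
Definition uea_opp : Uea -> Uea := uea_scale (-1).

Lemma uea_addE s t : uea_add (\pi_Uea s) (\pi_Uea t) = \pi_Uea (TAdd s t).
Proof.
by rewrite /uea_add; unlock; apply/ueaP; apply: ueq_add; exact: ueq_repr.
Qed.

Lemma uea_mulE s t : uea_mul (\pi_Uea s) (\pi_Uea t) = \pi_Uea (TMul s t).
Proof.
by rewrite /uea_mul; unlock; apply/ueaP; apply: ueq_mul; exact: ueq_repr.
Qed.

Lemma uea_scaleE c t : uea_scale c (\pi_Uea t) = \pi_Uea (TScale c t).
Proof.
by rewrite /uea_scale; unlock; apply/ueaP; apply: ueq_scale; exact: ueq_repr.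
Qed.

Let ueaE := (uea_addE, uea_mulE, uea_scaleE).

Fact uea_addA : associative uea_add.
Proof.
by elim/quotW=> s; elim/quotW=> t; elim/quotW=> u; rewrite !ueaE;
  apply/ueaP; exact: ueq_addA.
Qed.

Fact uea_addC : commutative uea_add.
Proof.
by elim/quotW=> s; elim/quotW=> t; rewrite !ueaE; apply/ueaP; exact: ueq_addC.
Qed.

Fact uea_add0 : left_id uea_zero uea_add.
Proof.
by elim/quotW=> s; rewrite /uea_zero !ueaE; apply/ueaP; exact: ueq_add0.
Qed.

Fact uea_addN : left_inverse uea_zero uea_opp uea_add.
Proof.
by elim/quotW=> s; rewrite /uea_opp !ueaE; apply/ueaP; exact: ueq_addN.
Qed.

HB.instance Definition _ :=
  GRing.isZmodule.Build Uea uea_addA uea_addC uea_add0 uea_addN.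

Fact uea_scaleA a b (u : Uea) :
  uea_scale a (uea_scale b u) = uea_scale (a * b) u.
Proof.
by elim/quotW: u => s; rewrite !ueaE; apply/ueaP; exact: ueq_scaleA.
Qed.

Fact uea_scale1 : left_id 1 uea_scale.
Proof. by elim/quotW=> s; rewrite !ueaE; apply/ueaP; exact: ueq_scale1. Qed.

Fact uea_scaleDr : right_distributive uea_scale uea_add.
Proof.
by move=> a; elim/quotW=> s; elim/quotW=> t; rewrite !ueaE;
  apply/ueaP; exact: ueq_scaleDr.
Qed.

Fact uea_scaleDl (u : Uea) :
  {morph uea_scale^~ u : a b / a + b >-> uea_add a b}.
Proof.
by move=> a b; elim/quotW: u => s; rewrite !ueaE; apply/ueaP; exact: ueq_scaleDl.
Qed.

HB.instance Definition _ := GRing.Zmodule_isLmodule.Build K Uea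
  uea_scaleA uea_scale1 uea_scaleDr uea_scaleDl.

Fact uea_mulA : associative uea_mul.
Proof.
by elim/quotW=> s; elim/quotW=> t; elim/quotW=> u; rewrite !ueaE;
  apply/ueaP; exact: ueq_mulA.
Qed.

Fact uea_mul1 : left_id uea_one uea_mul.
Proof.
by elim/quotW=> s; rewrite /uea_one !ueaE; apply/ueaP; exact: ueq_mul1.
Qed.

Fact uea_mulr1 : right_id uea_one uea_mul.
Proof.
by elim/quotW=> s; rewrite /uea_one !ueaE; apply/ueaP; exact: ueq_mulr1.
Qed.

Fact uea_mulDl : left_distributive uea_mul uea_add.
Proof.
by elim/quotW=> s; elim/quotW=> t; elim/quotW=> u; rewrite !ueaE;
  apply/ueaP; exact: ueq_mulDl.
Qed.

Fact uea_mulDr : right_distributive uea_mul uea_add.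
Proof.
by elim/quotW=> s; elim/quotW=> t; elim/quotW=> u; rewrite !ueaE;
  apply/ueaP; exact: ueq_mulDr.
Qed.

Fixpoint uterm_counit (t : uterm) : K :=
  match t with
  | TGen _ => 0
  | TZero => 0
  | TOne => 1
  | TAdd s t => uterm_counit s + uterm_counit t
  | TMul s t => uterm_counit s * uterm_counit t
  | TScale a t => a * uterm_counit t
  end.

Lemma ueq_counit s t : ueq s t -> uterm_counit s = uterm_counit t.
Proof.
elim=> //= *; rewrite ?(addr0, add0r, mulr0, mul0r, mul1r, mulr1, subr0) //;
  first [congruence | by rewrite addrA | by rewrite addrC | by rewrite mulrA
        | by rewrite mulN1r addNr | by rewrite mulrDr | by rewrite mulrDl
        | by rewrite mulrCA].
Qed.

Fact uea_oner_neq0 : uea_one != 0.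
Proof.
by apply/eqP => /ueaP/ueq_counit /= /eqP; rewrite oner_eq0.
Qed.

HB.instance Definition _ := GRing.Zmodule_isNzRing.Build Uea
  uea_mulA uea_mul1 uea_mulr1 uea_mulDl uea_mulDr uea_oner_neq0.

Fact uea_scaleAl a (u v : Uea) : a *: (u * v) = a *: u * v.
Proof.
elim/quotW: u => s; elim/quotW: v => t.
apply: (_ : uea_scale _ (uea_mul _ _) = uea_mul (uea_scale _ _) _).
by rewrite !ueaE; apply/ueaP; exact: ueq_scaleAl.
Qed.

HB.instance Definition _ := GRing.Lmodule_isLalgebra.Build K Uea uea_scaleAl.

Fact uea_scaleAr a (u v : Uea) : a *: (u * v) = u * (a *: v).
Proof.
elim/quotW: u => s; elim/quotW: v => t.
apply: (_ : uea_scale _ (uea_mul _ _) = uea_mul _ (uea_scale _ _)).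
by rewrite !ueaE; apply/ueaP; exact: ueq_scaleAr.
Qed.

HB.instance Definition _ := GRing.Lalgebra_isAlgebra.Build K Uea uea_scaleAr.

Definition uea_gen (x : L) : Uea := \pi_Uea (TGen x).

Section Action.
Variables (V : lmodType K) (rho : rep L V).

Fixpoint uterm_act (t : uterm) (v : V) : V :=
  match t with
  | TGen x => rho x v
  | TZero => 0
  | TOne => v
  | TAdd s t => uterm_act s v + uterm_act t v
  | TMul s t => uterm_act s (uterm_act t v)
  | TScale a t => a *: uterm_act t v
  end.

Lemma uterm_act_linear t a u v :
  uterm_act t (a *: u + v) = a *: uterm_act t u + uterm_act t v.
Proof.
elim: t a u v => [x|||s IHs t IHt|s IHs t IHt|b t IHt] a u v //=.
- exact: rep_linearr.
- by rewrite scaler0 addr0.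
- by rewrite IHs IHt scalerDr addrACA.
- by rewrite IHt IHs.
- by rewrite IHt scalerDr !scalerA mulrC.
Qed.

Lemma ueq_act s t : ueq s t -> uterm_act s =1 uterm_act t.
Proof.
have D t' u v : uterm_act t' (u + v) = uterm_act t' u + uterm_act t' v.
  by have := uterm_act_linear t' 1 u v; rewrite !scale1r.
have Z t' a u : uterm_act t' (a *: u) = a *: uterm_act t' u.
  have t0 : uterm_act t' 0 = 0.
    by apply: (addrI (uterm_act t' 0)); rewrite -D !addr0.
  by have := uterm_act_linear t' a u 0; rewrite t0 !addr0.
elim=> {s t} /=.
- by [].
- by move=> s t _ IH v; rewrite IH.
- by move=> s t u _ IH1 _ IH2 v; rewrite IH1 IH2.
- by move=> s s' t t' _ IH1 _ IH2 v; rewrite IH1 IH2.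
- by move=> s s' t t' _ IH1 _ IH2 v; rewrite IH1 IH2.
- by move=> a t t' _ IH v; rewrite IH.
- by move=> s t u v; rewrite addrA.
- by move=> s t v; rewrite addrC.
- by move=> t v; rewrite add0r.
- by move=> t v; rewrite scaleN1r addNr.
- by move=> a b t v; rewrite scalerA.
- by move=> t v; rewrite scale1r.
- by move=> a s t v; rewrite scalerDr.
- by move=> a b t v; rewrite scalerDl.
- by [].
- by [].
- by [].
- by [].
- by move=> s t u v; rewrite D.
- by [].
- by move=> a s t v; rewrite Z.
- by move=> a x y v; rewrite rep_linearl.
- by move=> x y v; rewrite rep_lie scaleN1r.
Qed.

Definition uea_act (u : Uea) (v : V) : V := uterm_act (repr u) v.

Lemma uea_act_pi t v : uea_act (\pi_Uea t) v = uterm_act t v.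
Proof. exact: (ueq_act (ueq_repr t)). Qed.

Lemma uea_act_gen x v : uea_act (uea_gen x) v = rho x v.
Proof. by rewrite uea_act_pi. Qed.

Lemma uea_act1 v : uea_act 1 v = v.
Proof. exact: (uea_act_pi TOne). Qed.

Lemma uea_actM (a b : Uea) v : uea_act (a * b) v = uea_act a (uea_act b v).
Proof.
elim/quotW: a => s; elim/quotW: b => t.
by rewrite [_ * _]uea_mulE !uea_act_pi.
Qed.

Lemma uea_actD (a b : Uea) v : uea_act (a + b) v = uea_act a v + uea_act b v.
Proof.
elim/quotW: a => s; elim/quotW: b => t.
by rewrite [_ + _ in LHS]uea_addE !uea_act_pi.
Qed.

Lemma uea_actZ c (a : Uea) v : uea_act (c *: a) v = c *: uea_act a v.
Proof.
by elim/quotW: a => s; rewrite [_ *: _ in LHS]uea_scaleE !uea_act_pi.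
Qed.

Definition uea_ann : set Uea := [set u | forall v, uea_act u v = 0]%classic.

End Action.
End Enveloping.

Record mxLie (K : fieldType) (N : nat) := MxLie {
  mxlie_space :> {vspace 'M[K]_N};
  mxlie_closed : forall A B, A \in mxlie_space -> B \in mxlie_space ->
    A *m B - B *m A \in mxlie_space
}.

Section MxLieAlgebra.
Variables (K : fieldType) (N : nat) (g : mxLie K N).

Definition mxlie_alg := subvs_of (mxlie_space g).
HB.instance Definition _ := Vector.on mxlie_alg.

Definition mxlie_lie (x y : mxlie_alg) : mxlie_alg :=
  Subvs (mxlie_closed (valP x) (valP y)).

Fact mxlie_linearl a x y z :
  mxlie_lie (a *: x + y) z = a *: mxlie_lie x z + mxlie_lie y z.
Proof.
apply: val_inj; rewrite /= mulmxDl mulmxDr -scalemxAl -scalemxAr scalerBr.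
by rewrite opprD addrACA.
Qed.

Fact mxlie_linearr a x y z :
  mxlie_lie x (a *: y + z) = a *: mxlie_lie x y + mxlie_lie x z.
Proof.
apply: val_inj; rewrite /= mulmxDl mulmxDr -scalemxAl -scalemxAr scalerBr.
by rewrite opprD addrACA.
Qed.

Fact mxliexx x : mxlie_lie x x = 0.
Proof. by apply: val_inj; rewrite /= subrr. Qed.

Fact mxlie_jacobi x y z :
  mxlie_lie x (mxlie_lie y z) + mxlie_lie y (mxlie_lie z x)
    + mxlie_lie z (mxlie_lie x y) = 0.
Proof.
apply: val_inj => /=; move: (val x) (val y) (val z) => A B C.
rewrite !(mulmxBl, mulmxBr) !mulmxA !opprB.
rewrite -!addrA.
set a := A *m B *m C; set b := A *m C *m B; set c := B *m C *m A.
set d := C *m B *m A; set e := B *m A *m C; set f := C *m A *m B.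
by apply/matrixP => i j; rewrite !mxE; ring.
Qed.

HB.instance Definition _ := Lmodule_isLie.Build K mxlie_alg
  mxlie_linearl mxlie_linearr mxliexx mxlie_jacobi.
End MxLieAlgebra.

Section Classical.
Variable K : fieldType.

Definition form N (u v : 'cV[K]_N) : K := (u^T *m v) 0 0.

Definition symJ n : 'M[K]_(n + n) := block_mx 0 1%:M (- 1%:M) 0.

Lemma symJ_tr n : (symJ n)^T = - symJ n.
Proof.
by rewrite /symJ tr_block_mx !trmx0 linearN /= trmx1 opp_block_mx oppr0 opprK.
Qed.

Definition symbar n (w : 'cV[K]_(n + n)) : 'cV[K]_(n + n) :=
  col_mx (dsubmx w) (- usubmx w).

Lemma symbarE n (w : 'cV[K]_(n + n)) : symbar w = symJ n *m w.
Proof.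
rewrite -{2}[w]vsubmxK mul_block_col !mul0mx !mul1mx mulNmx mul1mx.
by rewrite add0r addr0.
Qed.

Fact gl_closed N (A B : 'M[K]_N) : A \in fullv -> B \in fullv ->
  A *m B - B *m A \in fullv.
Proof. by rewrite !memvf. Qed.

Definition gl N : mxLie K N := MxLie (@gl_closed N).

Definition sl_map N (A : 'M[K]_N) : K^o := \tr A.

Fact sl_map_linear N : linear (@sl_map N).
Proof. by move=> a A B; rewrite /sl_map linearP. Qed.

HB.instance Definition _ N := GRing.isLinear.Build K _ _ _ (@sl_map N)
  (@sl_map_linear N).

Definition sl_space N : {vspace 'M[K]_N} := lker (linfun (@sl_map N)).

Lemma mem_sl N (A : 'M[K]_N) : (A \in sl_space N) = (\tr A == 0).
Proof. by rewrite memv_ker lfunE. Qed.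

Fact sl_closed N (A B : 'M[K]_N) : A \in sl_space N -> B \in sl_space N ->
  A *m B - B *m A \in sl_space N.
Proof. by move=> _ _; rewrite mem_sl raddfB /= mxtrace_mulC subrr. Qed.

Definition sl N : mxLie K N := MxLie (@sl_closed N).

Definition sp_map n (A : 'M[K]_(n + n)) : 'M[K]_(n + n) :=
  A^T *m symJ n + symJ n *m A.

Fact sp_map_linear n : linear (@sp_map n).
Proof.
move=> a A B; rewrite /sp_map linearP /= mulmxDl mulmxDr -scalemxAl -scalemxAr.
by rewrite scalerDr addrACA.
Qed.

HB.instance Definition _ n := GRing.isLinear.Build K _ _ _ (@sp_map n)
  (@sp_map_linear n).

Definition sp_space n : {vspace 'M[K]_(n + n)} := lker (linfun (@sp_map n)).

Lemma mem_sp n (A : 'M[K]_(n + n)) :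
  (A \in sp_space n) = (A^T *m symJ n + symJ n *m A == 0).
Proof. by rewrite memv_ker lfunE. Qed.

Fact sp_closed n (A B : 'M[K]_(n + n)) : A \in sp_space n -> B \in sp_space n ->
  A *m B - B *m A \in sp_space n.
Proof.
rewrite !mem_sp !addr_eq0 => /eqP hA /eqP hB.
rewrite linearB /= !trmx_mul mulmxBl -!mulmxA hA hB !mulmxN !mulmxA hA hB.
by rewrite mulmxBr !mulNmx !opprK -!mulmxA opprB.
Qed.

Definition sp n : mxLie K (n + n) := MxLie (@sp_closed n).

End Classical.

Inductive classical_type : Type :=
| TypeGL of nat
| TypeSL of nat
| TypeSp of nat.

Definition classical_ok (t : classical_type) : Prop :=
  match t with
  | TypeGL N | TypeSL N => (2 <= N)%N
  | TypeSp n => (1 <= n)%N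
  end.

Definition classical_dim (t : classical_type) : nat :=
  match t with
  | TypeGL N | TypeSL N => N
  | TypeSp n => n + n
  end.

Definition classical_lie (K : fieldType) (t : classical_type) :
    mxLie K (classical_dim t) :=
  match t with
  | TypeGL N => gl K N
  | TypeSL N => sl K N
  | TypeSp n => sp K n
  end.

Definition rank_one (K : fieldType) (t : classical_type) :
    set 'M[K]_(classical_dim t) :=
  match t with
  | TypeGL N => [set x : 'M[K]_N | x != 0 /\
      exists r u : 'cV[K]_N, x = r *m u^T]
  | TypeSL N => [set x : 'M[K]_N | x != 0 /\
      exists r u : 'cV[K]_N, form u r = 0 /\ x = r *m u^T]
  | TypeSp n => [set x : 'M[K]_(n + n) | x != 0 /\
      exists u : 'cV[K]_(n + n), x = u *m (symbar u)^T]
  end%classic.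

Lemma rank_one_mem (K : fieldType) (t : classical_type)
    (x : 'M[K]_(classical_dim t)) :
  rank_one x -> x \in mxlie_space (classical_lie K t).
Proof.
case: t x => [N|N|n] x [_].
- by rewrite memvf.
- by case=> r [u [ur0 ->]]; rewrite mem_sl mxtrace_mulC trace_mx11; apply/eqP.
- case=> u ->; rewrite mem_sp symbarE trmx_mul trmxK trmx_mul symJ_tr.
  by rewrite !mulmxN !mulmxA subrr.
Qed.

Section Exterior.
Variables (K : fieldType) (N : nat).

Definition psubset p := {S : {set 'I_N} | #|S| == p}.

Definition psub_elt p (S : psubset p) (j : 'I_p) : 'I_N :=
  enum_val (cast_ord (esym (eqP (valP S))) j).

(* The coordinates of w : extpow p are those of an element of the p-th exterior
   power of K^N in the basis e_S = e_{s_1} /\ ... /\ e_{s_p}, for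
   S = {s_1 < ... < s_p}. *)
Definition extpow p := {ffun psubset p -> K^o}.

Definition wedge p (v : 'I_p -> 'cV[K]_N) : extpow p :=
  [ffun S => \det (\matrix_(i < p, j < p) v i (psub_elt S j) 0)].

(* The linear map sending e_S to F (e_{s_1}, ..., e_{s_p}). If F is multilinear
   and alternating, it sends every wedge v to F v: see ext_lift_wedge. *)
Definition ext_lift (W : lmodType K) p (F : ('I_p -> 'cV[K]_N) -> W)
    (w : extpow p) : W :=
  \sum_(S : psubset p) w S *: F (fun j => delta_mx (psub_elt S j) 0).

Definition upd T p (v : 'I_p -> T) (i : 'I_p) (x : T) : 'I_p -> T :=
  fun j => if j == i then x else v j.

Definition ext_act p (A : 'M[K]_N) : extpow p -> extpow p :=
  ext_lift (fun v => \sum_(i < p) wedge (upd v i (A *m v i))).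

Definition multilinear (W : lmodType K) p (F : ('I_p -> 'cV[K]_N) -> W) :=
  forall v i a x y,
    F (upd v i (a *: x + y)) = a *: F (upd v i x) + F (upd v i y).

Definition alternating (W : lmodType K) p (F : ('I_p -> 'cV[K]_N) -> W) :=
  forall v i j, i != j -> v i = v j -> F v = 0.

Lemma ext_lift_linear (W : lmodType K) p (F : ('I_p -> 'cV[K]_N) -> W) :
  linear (ext_lift F).
Proof.
move=> a w1 w2; rewrite /ext_lift scaler_sumr -big_split; apply: eq_bigr => S _.
by rewrite !ffunE scalerDl scalerA.
Qed.

Lemma upd_upd T p (v : 'I_p -> T) i x y : upd (upd v i x) i y = upd v i y.
Proof. by apply: funext => j; rewrite /upd; case: eqP. Qed.

Lemma updC T p (v : 'I_p -> T) i j x y : i != j ->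
  upd (upd v i x) j y = upd (upd v j y) i x.
Proof.
move=> ij; apply: funext => k; rewrite /upd.
by case: (k =P j) => [->|//]; rewrite eq_sym (negbTE ij).
Qed.

Lemma upd_id T p (v : 'I_p -> T) i : upd v i (v i) = v.
Proof. by apply: funext => j; rewrite /upd; case: eqP => [->|]. Qed.

Lemma updE T p (v : 'I_p -> T) i x : upd v i x i = x.
Proof. by rewrite /upd eqxx. Qed.

Lemma updNE T p (v : 'I_p -> T) i x j : j != i -> upd v i x j = v j.
Proof. by rewrite /upd => /negbTE->. Qed.

Lemma psub_elt_inj p (S : psubset p) : injective (psub_elt S).
Proof. by move=> i j /enum_val_inj/cast_ord_inj. Qed.

Lemma psub_elt_mem p (S : psubset p) j : psub_elt S j \in val S.
Proof. exact: enum_valP. Qed.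

Lemma psub_elt_surj p (S : psubset p) x : x \in val S ->
  exists j, psub_elt S j = x.
Proof.
move=> xS; exists (cast_ord (eqP (valP S)) (enum_rank_in xS x)).
by rewrite /psub_elt cast_ord_comp cast_ord_id enum_rankK_in.
Qed.

Section Multilinear.
Variables (W : lmodType K) (p : nat) (F : ('I_p -> 'cV[K]_N) -> W).
Hypothesis Fml : multilinear F.

Lemma ml0 v i : F (upd v i 0) = 0.
Proof.
have := Fml v i 1 0 0; rewrite !scale1r addr0 => h.
by apply: (addrI (F (upd v i 0))); rewrite addr0 -h.
Qed.

Lemma mlD v i x y : F (upd v i (x + y)) = F (upd v i x) + F (upd v i y).
Proof. by have := Fml v i 1 x y; rewrite !scale1r. Qed.

Lemma mlZ v i a x : F (upd v i (a *: x)) = a *: F (upd v i x).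
Proof. by have := Fml v i a x 0; rewrite !addr0 ml0 addr0. Qed.

Lemma ml_sum (I : Type) (r : seq I) v i (c : I -> K) (x : I -> 'cV[K]_N) :
  F (upd v i (\sum_(k <- r) c k *: x k)) =
  \sum_(k <- r) c k *: F (upd v i (x k)).
Proof.
elim: r => [|k r IH]; first by rewrite !big_nil ml0.
by rewrite !big_cons Fml IH.
Qed.

Hypothesis Falt : alternating F.

Lemma alt_swap v i j : i != j ->
  F (upd (upd v i (v j)) j (v i)) = - F v.
Proof.
move=> ij; pose G x y := F (upd (upd v i x) j y).
have Gr x y y' : G x (y + y') = G x y + G x y' by exact: mlD.
have Gl x x' y : G (x + x') y = G x y + G x' y.
  by rewrite /G !(updC _ _ _ ij) mlD.
have G0 x : G x x = 0.
  by apply: (Falt ij); rewrite updE updNE // updE.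
have := G0 (v i + v j); rewrite Gl !Gr !G0 add0r addr0 addrC => /eqP.
rewrite addr_eq0 => /eqP; rewrite /G => ->.
by rewrite !upd_id.
Qed.

Lemma alt_tperm v i j : i != j -> F (v \o tperm i j) = - F v.
Proof.
move=> ij; rewrite -(alt_swap v ij); congr F.
apply: funext => k; rewrite /upd /=; case: tpermP => [->|->|/eqP ki /eqP kj].
- by rewrite (negbTE ij) eqxx.
- by rewrite eqxx.
- by rewrite (negbTE ki) (negbTE kj).
Qed.

Lemma alt_perm v (s : 'S_p) : F (v \o s) = (-1) ^+ s *: F v.
Proof.
have [ts -> tsP] := prod_tpermP s.
elim: ts v tsP => [|[i j] ts IH] v /=.
  by move=> _; rewrite big_nil odd_perm1 scale1r; congr F; apply: funext => k /=;
    rewrite perm1.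
case/andP=> /= ij tsP; rewrite big_cons odd_mul_tperm ij.
set s' := (\prod_(t <- ts) _)%g.
have -> : v \o (tperm i j * s')%g = (v \o s') \o tperm i j.
  by apply: funext => k /=; rewrite permM.
by rewrite alt_tperm // IH // signr_addb expr1 mulN1r scaleNr.
Qed.

End Multilinear.

Lemma ml_eq_basis (W : lmodType K) p (F G : ('I_p -> 'cV[K]_N) -> W) :
  multilinear F -> multilinear G ->
  (forall f : 'I_p -> 'I_N,
    F (fun i => delta_mx (f i) 0) = G (fun i => delta_mx (f i) 0)) ->
  F =1 G.
Proof.
move=> Fml Gml FG v.
suff H k (w : 'I_p -> 'cV[K]_N) :
    (forall i : 'I_p, (k <= i)%N -> exists m, w i = delta_mx m 0) -> F w = G w.
  by apply: (H p) => i; rewrite leqNgt ltn_ord.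
elim: k w => [|k IH] w wP.
  have [f fP] := choice (fun i => wP i (leq0n i)).
  by have -> : w = (fun i => delta_mx (f i) 0) by exact: funext.
case: (ltnP k p) => kp; last first.
  by apply: IH => i; rewrite leqNgt (leq_trans (ltn_ord i) kp).
pose i0 := Ordinal kp.
have wE : w i0 = \sum_m w i0 m 0 *: delta_mx m 0.
  by rewrite [LHS]matrix_sum_delta; apply: eq_bigr => m _; rewrite big_ord1.
rewrite -[w](upd_id _ i0) wE !ml_sum //; apply: eq_bigr => m _; congr (_ *: _).
apply: IH => i; rewrite leq_eqVlt => /predU1P[ik|ki].
  have -> : i = i0 by exact: val_inj.
  by exists m; rewrite updE.
have ii0 : i != i0 by apply: contraTneq ki => ->; rewrite ltnn.
by rewrite updNE //; exact: wP.
Qed.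

Lemma alt_eq_basis (W : lmodType K) p (F G : ('I_p -> 'cV[K]_N) -> W) :
  multilinear F -> alternating F -> multilinear G -> alternating G ->
  (forall S : psubset p, F (fun j => delta_mx (psub_elt S j) 0) =
                         G (fun j => delta_mx (psub_elt S j) 0)) ->
  F =1 G.
Proof.
move=> Fml Falt Gml Galt FG; apply: ml_eq_basis => // f.
have [/injectiveP f_inj|/injectivePn[i [j ij fij]]] := boolP (injectiveb f);
  last by rewrite (Falt _ i j) ?fij // (Galt _ i j) ?fij.
have cS : #|[set f i | i : 'I_p]| == p by rewrite card_imset // card_ord.
pose S : psubset p := Sub [set f i | i : 'I_p] cS.
have fS i : exists j, psub_elt S j == f i.
  have /psub_elt_surj[j <-] : f i \in val S by exact: imset_f.
  by exists j.
pose s0 i := xchoose (fS i).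
have s0E i : psub_elt S (s0 i) = f i by exact: (eqP (xchooseP (fS i))).
have s0_inj : injective s0 by move=> i j ij; apply: f_inj; rewrite -!s0E ij.
have -> : (fun i => delta_mx (f i) 0) =
    (fun j => delta_mx (psub_elt S j) 0 : 'cV[K]_N) \o perm s0_inj.
  by apply: funext => i /=; rewrite permE s0E.
by rewrite !alt_perm // FG.
Qed.

Lemma wedge_multilinear p : multilinear (@wedge p).
Proof.
move=> v i a x y; apply/ffunP => S; rewrite !ffunE.
rewrite -[RHS]/(a * _ + _) -[X in _ = _ + X]mul1r; apply: (determinant_multilinear (i0 := i)).
- by apply/rowP => j; rewrite !mxE !updE !mxE mul1r.
- by apply/matrixP => k j; rewrite !mxE !updNE // eq_sym neq_lift.
- by apply/matrixP => k j; rewrite !mxE !updNE // eq_sym neq_lift.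
Qed.

Lemma wedge_alternating p : alternating (@wedge p).
Proof.
move=> v i j ij vij; apply/ffunP => S; rewrite !ffunE.
by apply: (determinant_alternate ij) => k; rewrite !mxE vij.
Qed.

Lemma wedge_basis p (S : psubset p) :
  wedge (fun j => delta_mx (psub_elt S j) 0) = [ffun T => (T == S)%:R].
Proof.
apply/ffunP => T; rewrite !ffunE; have [->|TS] := eqVneq T S.
  rewrite -[RHS](det1 _ p); congr (\det _); apply/matrixP => i j.
  by rewrite !mxE andbT (inj_eq (@psub_elt_inj _ S)) eq_sym.
have /subsetPn[x xS xT] : ~~ (val S \subset val T).
  apply: contra TS => ST; rewrite eq_sym -val_eqE eqEcard ST.
  by rewrite (eqP (valP S)) (eqP (valP T)) leqnn.
have [i ix] := psub_elt_surj xS.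
rewrite (expand_det_row _ i) big1 // => j _; rewrite !mxE ix andbT.
rewrite (_ : _ == x = false) ?mul0r //; apply: contraNF xT => /eqP <-.
exact: psub_elt_mem.
Qed.

Lemma ext_lift_wedge (W : lmodType K) p (F : ('I_p -> 'cV[K]_N) -> W) :
  multilinear F -> alternating F -> forall v, ext_lift F (wedge v) = F v.
Proof.
move=> Fml Falt; apply: alt_eq_basis => //.
- by move=> v i a x y; rewrite wedge_multilinear ext_lift_linear.
- move=> v i j ij vij; rewrite (wedge_alternating ij vij).
  by rewrite /ext_lift big1 // => S _; rewrite ffunE scale0r.
move=> S; rewrite /ext_lift wedge_basis (bigD1 S) //= big1 ?addr0.
  by rewrite ffunE eqxx scale1r.
by move=> T TS; rewrite ffunE (negbTE TS) scale0r.
Qed.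

Lemma extpow_sum p (w : extpow p) :
  w = \sum_S w S *: wedge (fun j => delta_mx (psub_elt S j) 0).
Proof.
apply/ffunP => T; rewrite sum_ffunE (bigD1 T) //= big1 => [|S ST].
  by rewrite wedge_basis !ffunE eqxx addr0 [RHS]mulr1.
by rewrite wedge_basis !ffunE eq_sym (negbTE ST) scaler0.
Qed.

Lemma extpow_ind_linear (W : lmodType K) p (f g : extpow p -> W) :
  linear f -> linear g -> (forall v, f (wedge v) = g (wedge v)) -> f =1 g.
Proof.
move=> fl gl fg w.
have aux (h : extpow p -> W) : linear h ->
    h w = \sum_S w S *: h (wedge (fun j => delta_mx (psub_elt S j) 0)).
  move=> hl; have h0 : h 0 = 0.
    have := hl 1 0 0; rewrite !scale1r addr0 => e.
    by apply: (addrI (h 0)); rewrite addr0 -e.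
  rewrite {1}[w]extpow_sum; elim: (index_enum _) => [|S r IH].
    by rewrite !big_nil.
  by rewrite !big_cons hl IH.
by rewrite !aux //; apply: eq_bigr => S _; rewrite fg.
Qed.

Lemma ext_act_multilinear p A :
  multilinear (fun v : 'I_p -> _ => \sum_(i < p) wedge (upd v i (A *m v i))).
Proof.
move=> v i a x y; rewrite scaler_sumr -big_split; apply: eq_bigr => j _ /=.
have [->|ji] := eqVneq j i.
  by rewrite !updE !upd_upd mulmxDr -scalemxAr wedge_multilinear.
by rewrite !updNE // !(updC _ _ _ (_ : i != j)) 1?eq_sym // wedge_multilinear.
Qed.

Lemma ext_act_alternating p A :
  alternating (fun v : 'I_p -> _ => \sum_(i < p) wedge (upd v i (A *m v i))).
Proof.
move=> v i j ij vij; have ji : j != i by rewrite eq_sym.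
rewrite (bigD1 i) //= (bigD1 j) //= big1 ?addr0; last first.
  move=> k /andP[ki kj]; apply: (wedge_alternating ij).
  by rewrite !updNE // eq_sym.
apply/eqP; rewrite addr_eq0; apply/eqP.
rewrite -(alt_swap (@wedge_multilinear p) (@wedge_alternating p) _ ij).
congr wedge; apply: funext => k; rewrite /upd eqxx (negbTE ij).
case: (k =P i) => [->|_]; first by rewrite (negbTE ij) vij.
by case: (k =P j) => [->|].
Qed.

Lemma ext_act_wedge p A (v : 'I_p -> 'cV[K]_N) :
  ext_act A (wedge v) = \sum_(i < p) wedge (upd v i (A *m v i)).
Proof.
exact: (ext_lift_wedge (@ext_act_multilinear p A) (@ext_act_alternating p A)).
Qed.

Lemma ext_act_linear p A : linear (@ext_act p A).
Proof. exact: ext_lift_linear. Qed.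

HB.instance Definition _ p A :=
  GRing.isLinear.Build K _ _ _ (@ext_act p A) (@ext_act_linear p A).

Lemma ext_act_linearl p a A B (w : extpow p) :
  ext_act (a *: A + B) w = a *: ext_act A w + ext_act B w.
Proof.
rewrite /ext_act /ext_lift scaler_sumr -big_split; apply: eq_bigr => S _ /=.
rewrite scalerA mulrC -scalerA -scalerDr; congr (_ *: _).
rewrite scaler_sumr -big_split; apply: eq_bigr => i _ /=.
by rewrite mulmxDl -scalemxAl wedge_multilinear.
Qed.

Lemma ext_act_lie p A B (w : extpow p) :
  ext_act (A *m B - B *m A) w = ext_act A (ext_act B w) - ext_act B (ext_act A w).
Proof.
move: w; apply: extpow_ind_linear.
- exact: ext_act_linear.
- move=> a x y; rewrite !ext_act_linear scalerBr opprD addrACA.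
  by rewrite -!addrA; congr (_ + _).
move=> v; rewrite !ext_act_wedge (linear_sum (@ext_act p A)) (linear_sum (@ext_act p B)).
under [X in _ = X - _]eq_bigr do rewrite /= ext_act_wedge.
under [X in _ = _ - X]eq_bigr do rewrite /= ext_act_wedge.
rewrite [X in _ = _ - X]exchange_big -sumrB; apply: eq_bigr => i _ /=.
rewrite -sumrB (bigD1 i) //= big1 ?addr0.
  rewrite !updE !upd_upd !mulmxA mulmxBl (mlD (@wedge_multilinear p)).
  by rewrite -scaleN1r (mlZ (@wedge_multilinear p)) scaleN1r.
move=> j ji; have ij : i != j by rewrite eq_sym.
by rewrite !updNE // (updC _ _ _ ji) subrr.
Qed.

End Exterior.

Section Theta.
Variables (K : fieldType) (n : nat).

(* The value of theta_p, p = q + 2, on v_1 /\ ... /\ v_p. For i : 'I_q.+1 and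
   j : 'I_q.+2 with i < j, lift j i is i seen in 'I_q.+2, and k |-> lift j (lift
   i k) enumerates the indices other than i and j. Indices start at 0, so the
   sign (-1)^(i+j-1) becomes (-1)^(i+j+1). *)
Definition theta_wedge q (v : 'I_q.+2 -> 'cV[K]_(n + n)) : extpow K (n + n) q :=
  \sum_(j < q.+2) \sum_(i < q.+1 | (i < j)%N)
    ((-1) ^+ (i + j).+1 * form (symbar (v (lift j i))) (v j)) *:
      wedge (fun k => v (lift j (lift i k))).

Definition theta q : extpow K (n + n) q.+2 -> extpow K (n + n) q :=
  ext_lift (@theta_wedge q).

Lemma theta_linear q : linear (@theta q).
Proof. exact: ext_lift_linear. Qed.

HB.instance Definition _ q :=
  GRing.isLinear.Build K _ _ _ (@theta q) (@theta_linear q).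

Lemma sum_pairs (W : zmodType) q (g : 'I_q.+2 -> 'I_q.+1 -> W) :
  \sum_(a < q.+2) \sum_(b < q.+1 | (a <= b)%N) g a b =
  \sum_(j < q.+2) \sum_(i < q.+1 | (i < j)%N) g (lift j i) (inord j.-1).
Proof.
rewrite !pair_big_dep /=.
pose h (u : 'I_q.+2 * 'I_q.+1) : 'I_q.+2 * 'I_q.+1 :=
  (lift u.1 u.2, inord u.1.-1).
pose h' (u : 'I_q.+2 * 'I_q.+1) : 'I_q.+2 * 'I_q.+1 :=
  (lift u.1 u.2, inord u.1).
have h'K (u : 'I_q.+2 * 'I_q.+1) : (u.1 <= u.2)%N -> h (h' u) = u.
  case: u => a b /= ab; rewrite /h /h' /=; congr (_, _); apply: val_inj => /=.
    rewrite inordK; first by rewrite /bump; lia.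
    by have := ltn_ord b; lia.
  by rewrite inordK /bump; have := ltn_ord b; lia.
have hK (u : 'I_q.+2 * 'I_q.+1) : (u.2 < u.1)%N -> h' (h u) = u.
  case: u => j i /= ij; rewrite /h /h' /=; congr (_, _); apply: val_inj => /=.
    rewrite inordK; first by rewrite /bump; lia.
    by have := ltn_ord j; lia.
  by rewrite inordK /bump; have := ltn_ord i; lia.
rewrite (reindex_onto h h') => [|u]; last exact: h'K.
apply: eq_big => [[j i]|//] /=; apply/andP/idP => [[+ /eqP]|ij].
  have ltj := ltn_ord j; have lti := ltn_ord i.
  by rewrite /bump inordK => [+ _|]; lia.
split; last by rewrite hK.
by rewrite /bump inordK; have := ltn_ord j; lia.
Qed.

Lemma sum_antisym q (f : 'I_q.+2 -> 'I_q.+2 -> K)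
    (D : ('I_q -> 'I_q.+2) -> K) :
  \sum_(a < q.+2) \sum_(b < q.+1)
     (-1) ^+ (a + b) * f a (lift a b) * D (fun k => lift a (lift b k)) =
  \sum_(j < q.+2) \sum_(i < q.+1 | (i < j)%N)
     (-1) ^+ (i + j).+1 * (f (lift j i) j - f j (lift j i)) *
       D (fun k => lift j (lift i k)).
Proof.
under eq_bigr => a _ do rewrite (bigID (fun b : 'I_q.+1 => (b < a)%N)) /=.
rewrite big_split /=.
under [X in _ + X]eq_bigr => a _ do under eq_bigl => b do rewrite -leqNgt.
rewrite sum_pairs -big_split; apply: eq_bigr => j _ /=.
rewrite -big_split; apply: eq_bigr => i ij /=.
have ltj := ltn_ord j; have lti := ltn_ord i.
have -> : lift (lift j i) (inord j.-1 : 'I_q.+1) = j.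
  by apply: val_inj => /=; rewrite inordK /bump; lia.
have -> : (fun k => lift (lift j i) (lift (inord j.-1 : 'I_q.+1) k)) =
          (fun k => lift j (lift i k)).
  by apply: funext => k; apply: val_inj => /=; rewrite inordK /bump; lia.
have -> : (bump j i + (inord j.-1 : 'I_q.+1))%N = (i + j).-1.
  by rewrite inordK /bump; lia.
have e : (i + j)%N = (i + j).-1.+1 by lia.
by rewrite [(j + i)%N]addnC e /= !exprS; ring.
Qed.

(* Column 0 of det_mx v x y T lists the coordinates x of the vectors v_i,
   column 1 their coordinates y, the remaining ones the coordinates in T. *)
Let det_mx q (v : 'I_q.+2 -> 'cV[K]_(n + n)) (x y : 'I_(n + n))
    (T : psubset (n + n) q) : 'M[K]_q.+2 :=
  \matrix_(i, j) v i (if unlift ord0 j is Some j' then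
    (if unlift ord0 j' is Some k then psub_elt T k else y) else x) 0.

Lemma det_mxE q (v : 'I_q.+2 -> 'cV[K]_(n + n)) x y T :
  \det (det_mx v x y T) =
  \sum_(j < q.+2) \sum_(i < q.+1 | (i < j)%N) (-1) ^+ (i + j).+1 *
    (v (lift j i) x 0 * v j y 0 - v j x 0 * v (lift j i) y 0) *
    wedge (fun k => v (lift j (lift i k))) T.
Proof.
rewrite -(sum_antisym (fun a b => v a x 0 * v b y 0)
  (fun h => wedge (fun k => v (h k)) T)).
rewrite (expand_det_col _ ord0); apply: eq_bigr => a _.
rewrite !mxE unlift_none /cofactor (expand_det_col _ ord0) big_distrr big_distrr.
apply: eq_bigr => b _ /=; rewrite !mxE liftK unlift_none /cofactor !addn0.
rewrite ffunE exprD.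
have -> : row' b (col' ord0 (row' a (col' ord0 (det_mx v x y T)))) =
    \matrix_(i, j) v (lift a (lift b i)) (psub_elt T j) 0.
  by apply/matrixP => i j; rewrite !mxE !liftK.
by ring.
Qed.

Lemma form_symbar (u v : 'cV[K]_(n + n)) : form (symbar u) v =
  \sum_(m < n) (u (rshift n m) 0 * v (lshift n m) 0
              - u (lshift n m) 0 * v (rshift n m) 0).
Proof.
rewrite /form mxE big_split_ord /= -big_split /=; apply: eq_bigr => m _.
by rewrite !mxE (unsplitK (inl _)) (unsplitK (inr _)) !mxE mulNr.
Qed.

Lemma theta_wedge_det q (v : 'I_q.+2 -> 'cV[K]_(n + n)) T :
  theta_wedge v T = \sum_(m < n) \det (det_mx v (rshift n m) (lshift n m) T).
Proof.
under eq_bigr do rewrite det_mxE.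
rewrite exchange_big sum_ffunE; apply: eq_bigr => j _ /=.
rewrite exchange_big sum_ffunE; apply: eq_bigr => i _ /=.
rewrite -mulr_suml -mulr_sumr form_symbar !ffunE.
congr (_ * _ * _); apply: eq_bigr => m _.
by rewrite [v j _ _ * _]mulrC.
Qed.

Lemma theta_wedge_multilinear q : multilinear (@theta_wedge q).
Proof.
move=> v i a x y; apply/ffunP => T; rewrite !ffunE !theta_wedge_det.
rewrite -[RHS]/(a * _ + _) mulr_sumr -big_split; apply: eq_bigr => m _ /=.
rewrite -[X in _ = _ + X]mul1r; apply: (determinant_multilinear (i0 := i)).
- by apply/rowP => j; rewrite !mxE !updE !mxE mul1r.
- by apply/matrixP => k j; rewrite !mxE !updNE // eq_sym neq_lift.
- by apply/matrixP => k j; rewrite !mxE !updNE // eq_sym neq_lift.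
Qed.

Lemma theta_wedge_alternating q : alternating (@theta_wedge q).
Proof.
move=> v i j ij vij; apply/ffunP => T; rewrite theta_wedge_det ffunE.
by apply: big1 => m _; apply: (determinant_alternate ij) => k; rewrite !mxE vij.
Qed.

Lemma theta_wedgeE q (v : 'I_q.+2 -> 'cV[K]_(n + n)) :
  theta (wedge v) = theta_wedge v.
Proof.
exact: (ext_lift_wedge (@theta_wedge_multilinear q) (@theta_wedge_alternating q)).
Qed.

Lemma form_sp (A : 'M[K]_(n + n)) u v : A \in sp_space K n ->
  form (symbar (A *m u)) v + form (symbar u) (A *m v) = 0.
Proof.
rewrite mem_sp addr_eq0 => /eqP hA; rewrite /form !symbarE !trmx_mul.
rewrite symJ_tr !(mulmxN, mulNmx) -!mulmxA (mulmxA A^T) hA !(mulmxN, mulNmx).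
have oppE (M : 'M[K]_1) : (- M) 0 0 = - M 0 0 by rewrite mxE.
by rewrite opprK -!mulmxA oppE subrr.
Qed.

Lemma theta_act q (A : 'M[K]_(n + n)) (w : extpow K (n + n) q.+2) :
  A \in sp_space K n -> theta (ext_act A w) = ext_act A (theta w).
Proof.
move=> Asp; move: w; apply: extpow_ind_linear.
- by move=> a x y; rewrite ext_act_linear theta_linear.
- by move=> a x y; rewrite theta_linear ext_act_linear.
move=> v; rewrite ext_act_wedge theta_wedgeE (linear_sum (@theta q)) /=.
under eq_bigr do rewrite theta_wedgeE.
rewrite exchange_big (linear_sum (@ext_act K _ q A)) /=; apply: eq_bigr => j _.
rewrite exchange_big (linear_sum (@ext_act K _ q A)) /=; apply: eq_bigr => i ij.
rewrite linearZ_LR /= ext_act_wedge.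
rewrite (bigD1_ord j) //= (bigD1_ord i) //= addrA -[RHS]add0r.
have ji : lift j i != j by rewrite eq_sym neq_lift.
have ji' : j != lift j i by exact: neq_lift.
have jk' k : j != lift j (lift i k) by exact: neq_lift.
have ik' k : lift j i != lift j (lift i k).
  by rewrite (inj_eq lift_inj) neq_lift.
have jk k : lift j (lift i k) != j by rewrite eq_sym neq_lift.
have ik k : lift j (lift i k) != lift j i.
  by rewrite (inj_eq lift_inj) eq_sym neq_lift.
congr (_ + _).
  have -> : (fun k => upd v j (A *m v j) (lift j (lift i k))) =
            (fun k => v (lift j (lift i k))).
    by apply: funext => k; rewrite updNE.
  have -> : (fun k => upd v (lift j i) (A *m v (lift j i)) (lift j (lift i k))) =
            (fun k => v (lift j (lift i k))).
    by apply: funext => k; rewrite updNE.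
  rewrite !updE !updNE // -scalerDl -mulrDr addrC form_sp //.
  by rewrite mulr0 scale0r.
rewrite scaler_sumr; apply: eq_bigr => l _.
rewrite !updNE //; congr (_ *: wedge _).
apply: funext => k; rewrite /upd.
by rewrite !(inj_eq lift_inj).
Qed.

End Theta.

Section Representations.
Variable K : fieldType.

Section TrivialRep.
Variable L : lieAlgType K.

Definition zero_act (x : L) (v : K^o) : K^o := 0.

Fact zero_act_linearl a x y v :
  zero_act (a *: x + y) v = a *: zero_act x v + zero_act y v.
Proof. by rewrite /zero_act scaler0 addr0. Qed.

Fact zero_act_linearr x a u v :
  zero_act x (a *: u + v) = a *: zero_act x u + zero_act x v.
Proof. by rewrite /zero_act scaler0 addr0. Qed.

Fact zero_act_lie x y v :
  zero_act (lie x y) v = zero_act x (zero_act y v) - zero_act y (zero_act x v).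
Proof. by rewrite /zero_act subr0. Qed.

Definition trivial_rep : rep L K^o :=
  Rep zero_act_linearl zero_act_linearr zero_act_lie.

End TrivialRep.

Section ExteriorRep.
Variables (N : nat) (g : mxLie K N).

Definition nat_act (x : mxlie_alg g) (v : 'cV[K]_N) : 'cV[K]_N := val x *m v.

Fact nat_act_linearl a x y v :
  nat_act (a *: x + y) v = a *: nat_act x v + nat_act y v.
Proof. by rewrite /nat_act /= mulmxDl scalemxAl. Qed.

Fact nat_act_linearr x a u v :
  nat_act x (a *: u + v) = a *: nat_act x u + nat_act x v.
Proof. by rewrite /nat_act mulmxDr scalemxAr. Qed.

Fact nat_act_lie x y v :
  nat_act (lie x y) v = nat_act x (nat_act y v) - nat_act y (nat_act x v).
Proof. by rewrite /nat_act /= mulmxBl !mulmxA. Qed.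

Definition nat_rep : rep (mxlie_alg g) 'cV[K]_N :=
  Rep nat_act_linearl nat_act_linearr nat_act_lie.

Variable p : nat.

Definition mxlie_ext_act (x : mxlie_alg g) : extpow K N p -> extpow K N p :=
  ext_act (val x).

Fact mxlie_ext_act_linearl a x y v :
  mxlie_ext_act (a *: x + y) v = a *: mxlie_ext_act x v + mxlie_ext_act y v.
Proof. exact: ext_act_linearl. Qed.

Fact mxlie_ext_act_linearr x a u v :
  mxlie_ext_act x (a *: u + v) = a *: mxlie_ext_act x u + mxlie_ext_act x v.
Proof. exact: ext_act_linear. Qed.

Fact mxlie_ext_act_lie x y v :
  mxlie_ext_act (lie x y) v =
  mxlie_ext_act x (mxlie_ext_act y v) - mxlie_ext_act y (mxlie_ext_act x v).
Proof. exact: ext_act_lie. Qed.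

Definition ext_rep : rep (mxlie_alg g) (extpow K N p) :=
  Rep mxlie_ext_act_linearl mxlie_ext_act_linearr mxlie_ext_act_lie.

End ExteriorRep.

Section SymplecticFundamental.
Variables (n q : nat).

Definition theta_ker : {vspace extpow K (n + n) q.+2} :=
  lker (linfun (@theta K n q)).

Lemma mem_theta_ker w : (w \in theta_ker) = (theta w == 0).
Proof. by rewrite memv_ker lfunE. Qed.

Fact theta_ker_stable (x : mxlie_alg (sp K n)) w :
  w \in theta_ker -> ext_act (val x) w \in theta_ker.
Proof.
rewrite !mem_theta_ker => /eqP tw; rewrite theta_act ?tw ?(valP x) //.
by rewrite (linear0 (@ext_act K _ q (val x))).
Qed.

Definition theta_ker_act (x : mxlie_alg (sp K n)) (w : subvs_of theta_ker) :
    subvs_of theta_ker := Subvs (theta_ker_stable x (valP w)).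

Fact theta_ker_act_linearl a x y w :
  theta_ker_act (a *: x + y) w = a *: theta_ker_act x w + theta_ker_act y w.
Proof. by apply: val_inj; exact: ext_act_linearl. Qed.

Fact theta_ker_act_linearr x a u w :
  theta_ker_act x (a *: u + w) = a *: theta_ker_act x u + theta_ker_act x w.
Proof. by apply: val_inj; exact: ext_act_linear. Qed.

Fact theta_ker_act_lie x y w :
  theta_ker_act (lie x y) w =
  theta_ker_act x (theta_ker_act y w) - theta_ker_act y (theta_ker_act x w).
Proof. by apply: val_inj; exact: ext_act_lie. Qed.

Definition theta_ker_rep : rep (mxlie_alg (sp K n)) (subvs_of theta_ker) :=
  Rep theta_ker_act_linearl theta_ker_act_linearr theta_ker_act_lie.

End SymplecticFundamental.

Definition is_trivial (L : lieAlgType K) (V : lmodType K) (rho : rep L V) :=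
  rep_iso rho (trivial_rep L).

Definition is_fundamental (t : classical_type) (V : lmodType K) :
    rep (mxlie_alg (classical_lie K t)) V -> Prop :=
  match t with
  | TypeGL N => fun rho =>
      exists p, (1 <= p < N)%N /\ rep_iso rho (ext_rep (gl K N) p)
  | TypeSL N => fun rho =>
      exists p, (1 <= p < N)%N /\ rep_iso rho (ext_rep (sl K N) p)
  | TypeSp n => fun rho =>
      rep_iso rho (nat_rep (sp K n)) \/
      exists q, (q.+2 <= n)%N /\ rep_iso rho (theta_ker_rep n q)
  end.

(* For gl_N the fundamental representations stop at p = N - 1. The determinant
   representation, the N-th exterior power of K^N, on which x acts as tr x, is
   thus neither trivial nor fundamental, although x^2 - tr(x) x annihilates it
   for every x. It has to be listed next to them in a classification. *)
Definition is_determinant (t : classical_type) (V : lmodType K) :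
    rep (mxlie_alg (classical_lie K t)) V -> Prop :=
  match t with
  | TypeGL N => fun rho => rep_iso rho (ext_rep (gl K N) N)
  | TypeSL _ | TypeSp _ => fun _ => False
  end.

End Representations.

(* Main.v *)
(* From (1) to (2). On [V] the elements [E_ii] of gl_N are idempotent, and in
   sl_N and sp_N the relations [e^2 = f^2 = 0] in a rank-one sl_2-triple force
   [h^3 = h]. Hence a Cartan subalgebra acts through commuting operators with
   eigenvalues in {-1, 0, 1}: only finitely many weights are possible, so that a
   weight vector of maximal height exists and is a highest weight vector, also
   when [V] is not assumed to be a weight module. The same bound on the
   eigenvalues forces its weight to be that of the trivial module, of a
   fundamental module, or of the determinant. An irreducible module is determined
   by its highest weight, so it remains to see that the models are irreducible.
   They satisfy (1) as well, so each of their nonzero submodules contains a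
   highest weight vector, which is shown to be a multiple of the standard one;
   a contravariant symmetric form that does not vanish on the latter excludes
   proper submodules. *)

Require Import Defs.
From HB Require Import structures.
From mathcomp Require Import all_boot all_order all_algebra perm.
From mathcomp Require Import boolp classical_sets reals complex.
From mathcomp Require Import zify ring.

Set Implicit Arguments.
Unset Strict Implicit.
Unset Printing Implicit Defensive.

Import Order.TTheory GRing.Theory Num.Theory.
Local Open Scope ring_scope.

(** * Highest weight theory *)

(** As [V] may be infinite-dimensional, neither complete reducibility nor the usual source of
    dominance is at hand. Dominance comes instead from a single lowering step: if [e] kills the
    highest weight vector [v] and [[e, f]] acts on it by a non-zero scalar, then [f v] is non-zero
    and its weight is subject to the same bound; a weight that is not dominant fails this test.
    Uniqueness avoids Verma modules and bases of the enveloping algebra: a highest weight vector is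
    separated from its descendants by the spectrum of one element, [cartan_sum]. For the models, the
    possible highest weights are so few that, in a given exterior power, comparing cardinals leaves
    one. The symplectic case resists, because a pair of indices m, n + m has weight zero, so that
    the weight does not single out a basis vector; the kernel of [theta] serves to exclude such
    pairs. *)

Section RepLinear.
Variables (K : fieldType) (L : lieAlgType K) (V : lmodType K) (rho : rep L V).

HB.instance Definition _ (x : L) :=
  GRing.isLinear.Build K V V *:%R (rep_fun rho x) (rep_linearr rho x).

Lemma rep_addl x y v : rho (x + y) v = rho x v + rho y v.
Proof. by have := rep_linearl rho 1 x y v; rewrite !scale1r. Qed.

Lemma rep0l v : rho 0 v = 0.
Proof. by apply: (addrI (rho 0 v)); rewrite -rep_addl !addr0. Qed.

Lemma rep_scalel a x v : rho (a *: x) v = a *: rho x v.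
Proof. by have := rep_linearl rho a x 0 v; rewrite !addr0 rep0l addr0. Qed.

Lemma rep_scaler x a v : rho x (a *: v) = a *: rho x v.
Proof. exact: linearZ_LR. Qed.

Lemma rep0r x : rho x 0 = 0.
Proof. exact: linear0. Qed.

Lemma rep_addr x u v : rho x (u + v) = rho x u + rho x v.
Proof. exact: linearD. Qed.

Lemma rep_oppr x v : rho x (- v) = - rho x v.
Proof. exact: linearN. Qed.

Lemma rep_subr x u v : rho x (u - v) = rho x u - rho x v.
Proof. exact: linearB. Qed.

Lemma rep_suml (I : Type) (r : seq I) (F : I -> L) v :
  rho (\sum_(i <- r) F i) v = \sum_(i <- r) rho (F i) v.
Proof.
by elim: r => [|i r IH]; rewrite ?big_nil ?rep0l // !big_cons rep_addl IH.
Qed.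

Lemma rep_swap x y v : rho x (rho y v) = rho y (rho x v) + rho (lie x y) v.
Proof. by rewrite rep_lie addrC subrK. Qed.

End RepLinear.

(* The integers [level i] are the coordinates of a grading element on the
   [cartan i]; it defines the height of a root, hence which roots are positive. *)
Record root_data (K : numFieldType) (L : lieAlgType K) := RootData {
  rank : nat;
  root_ix : Type;
  cartan : 'I_rank -> L;
  root_vec : root_ix -> L;
  root : root_ix -> 'I_rank -> int;
  level : 'I_rank -> int;
  cartanC : forall i j, lie (cartan i) (cartan j) = 0;
  cartan_root : forall i r,
    lie (cartan i) (root_vec r) = (root r i)%:~R *: root_vec r;
  root_span : forall P : L -> Prop,
    (forall a x y, P x -> P y -> P (a *: x + y)) ->
    (forall i, P (cartan i)) ->
    (forall r, \sum_i level i * root r i != 0 -> P (root_vec r)) ->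
    P 0 -> forall x, P x
}.

Definition height (K : numFieldType) (L : lieAlgType K) (D : root_data L)
    (mu : 'I_(rank D) -> int) : int :=
  \sum_i level i * mu i.

Section HighestWeight.
Variables (K : numFieldType) (L : lieAlgType K) (D : root_data L).
Local Notation H := (@cartan K L D).
Local Notation X := (@root_vec K L D).
Local Notation al := (@root K L D).
Local Notation weight := ('I_(rank D) -> int).

(** * Existence of highest weight vectors *)

Section Rep.
Variables (V : lmodType K) (rho : rep L V).

Definition weight_vec (mu : weight) (v : V) :=
  forall i, rho (H i) v = (mu i)%:~R *: v.

Definition is_hw (mu : weight) (v : V) :=
  weight_vec mu v /\ forall r, 0 < height (al r) -> rho (X r) v = 0.

Definition tripotent :=
  forall i v, rho (H i) (rho (H i) (rho (H i) v)) = rho (H i) v.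

Lemma weight_shift mu v f (be : weight) :
  (forall i, lie (H i) f = (be i)%:~R *: f) -> weight_vec mu v ->
  weight_vec (fun i => mu i + be i) (rho f v).
Proof.
move=> Hf Hv i; rewrite rep_swap Hv Hf rep_scaler rep_scalel -scalerDl.
by rewrite -intrD.
Qed.

Lemma tripotent_eig (i : 'I_(rank D)) m v : tripotent -> v != 0 ->
  rho (H i) v = m%:~R *: v -> `|m| <= 1.
Proof.
move=> t vn0 Hv; have := t i v; rewrite !(Hv, rep_scaler) !scalerA.
move/eqP; rewrite -subr_eq0 -scalerBl scaler_eq0 (negPf vn0) orbF.
rewrite -!intrM -intrB intr_eq0 => /eqP h.
have : m * (m - 1) * (m + 1) = 0 by rewrite -[RHS]h; ring.
by move=> /eqP; rewrite !mulf_eq0; lia.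
Qed.

(** As [e] kills [v], applying [e] to [f v] gives [[e, f] v]; so [f v] is non-zero, and tripotency
    bounds its weight. *)
Lemma reflect_weight mu v e f (be : weight) : tripotent ->
  (forall i, lie (H i) f = (be i)%:~R *: f) -> weight_vec mu v ->
  rho e v = 0 -> rho (lie e f) v != 0 -> forall i, `|mu i + be i| <= 1.
Proof.
move=> t Hf Hv ev efv i; apply: (tripotent_eig t _ (weight_shift Hf Hv i)).
apply: contraNneq efv => fv.
by rewrite rep_lie fv ev !rep0r subrr.
Qed.

(** Since h^3 = h, the vectors h^2 v + h v and h^2 v - h v are eigenvectors for 1 and -1; if both
    vanish, then 2 h v = 0 and [v] has eigenvalue 0. In the application [S] is the joint eigenspace
    of the Cartan elements already treated. *)
Lemma tripotent_eigvec (U : set V) (S : V -> Prop) (i : 'I_(rank D)) v :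
  tripotent -> submodule rho U -> S 0 ->
  (forall a u w, S u -> S w -> S (a *: u + w)) ->
  (forall u, S u -> S (rho (H i) u)) -> U v -> v != 0 -> S v ->
  exists2 w, [/\ U w, w != 0 & S w] &
    exists m : int, rho (H i) w = m%:~R *: w.
Proof.
move=> t [U0 Ul UH] S0 Sl SH Uv vn0 Sv.
pose h u := rho (H i) u.
have Uh k : U (iter k h v) by elim: k => //= k; exact: UH.
have Sh k : S (iter k h v) by elim: k => //= k; exact: SH.
have h3 : h (h (h v)) = h v by exact: t.
have hD (a : K) u w : h (a *: u + w) = a *: h u + h w by exact: rep_linearr.
case: (eqVneq (1 *: h v + h (h v)) 0) => [e1|n1]; last first.
  exists (1 *: h v + h (h v)).
    split=> //; first exact: (Ul 1 _ _ (Uh 1%N) (Uh 2%N)).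
    exact: (Sl 1 _ _ (Sh 1%N) (Sh 2%N)).
  exists 1; rewrite -/(h _) hD h3 !scale1r; exact: addrC.
case: (eqVneq ((-1) *: h v + h (h v)) 0) => [e2|n2]; last first.
  exists ((-1) *: h v + h (h v)).
    split=> //; first exact: (Ul (-1) _ _ (Uh 1%N) (Uh 2%N)).
    exact: (Sl (-1) _ _ (Sh 1%N) (Sh 2%N)).
  by exists (-1); rewrite -/(h _) hD h3 !scaleN1r opprD opprK addrC.
exists v; first by split.
exists 0; rewrite scale0r -/(h v).
have : (2%:R : K) *: h v = 0.
  rewrite -[RHS]subr0 -{1}e1 -e2 scale1r scaleN1r opprD opprK addrACA subrr addr0.
  by rewrite scaler_nat mulr2n.
by move=> /eqP; rewrite scaler_eq0 pnatr_eq0 => /eqP.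
Qed.

Lemma weight_vec_exists (U : set V) : tripotent -> submodule rho U ->
  (exists2 v, U v & v != 0) ->
  exists2 v, U v /\ v != 0 & exists mu, weight_vec mu v.
Proof.
move=> t Um [v Uv vn0].
suff /(_ (rank D))[w [Uw wn0] Hw] : forall k, exists2 w, U w /\ w != 0 &
    forall i : 'I_(rank D), (i < k)%N ->
      exists m : int, rho (H i) w = m%:~R *: w.
  have /choice[mu muP] : forall i, exists m : int, rho (H i) w = m%:~R *: w.
    by move=> i; exact: Hw.
  by exists w => //; exists mu.
elim=> [|k [w [Uw wn0] Hw]]; first by exists v.
case: (ltnP k (rank D)) => kr; last first.
  by exists w => // i _; apply: Hw; exact: leq_trans (ltn_ord i) kr.
(* The value 0 for [i] beyond [k] is a default that makes the choice of [mu] total. *)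
have Hw' (i : 'I_(rank D)) : exists m : int, (i < k)%N -> rho (H i) w = m%:~R *: w.
  by case: (boolP (i < k)%N) => [/Hw[m]|_]; [exists m|exists 0].
have {Hw'}[mu Hmu] := choice Hw'.
pose S u := forall i : 'I_(rank D), (i < k)%N -> rho (H i) u = (mu i)%:~R *: u.
have Sl a u x : S u -> S x -> S (a *: u + x).
  move=> Su Sx i ik; rewrite rep_linearr Su // Sx // scalerDr !scalerA.
  by rewrite mulrC.
have SH u : S u -> S (rho (H (Ordinal kr)) u).
  move=> Su i ik; rewrite rep_swap cartanC rep0l addr0 Su //.
  by rewrite rep_scaler.
have S0 : S 0 by move=> i _; rewrite rep0r scaler0.
have [x [Ux xn0 Sx] [m xm]] := tripotent_eigvec t Um S0 Sl SH Uw wn0 Hmu.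
exists x => // i; rewrite ltnS leq_eqVlt => /predU1P[ik|ik]; last first.
  by exists (mu i); exact: Sx.
by exists m; rewrite (_ : i = Ordinal kr) //; exact: val_inj.
Qed.

Lemma hw_exists (U : set V) : tripotent -> submodule rho U ->
  (exists2 v, U v & v != 0) ->
  exists mu, exists v, [/\ U v, v != 0 & is_hw mu v].
Proof.
move=> t Um Un0; have [v0 [Uv0 v0n0] [mu0 Hmu0]] := weight_vec_exists t Um Un0.
(* Coding the entries -1, 0, 1 as 0, 1, 2 puts all weights in a finite type, where the height
   attains a maximum. *)
pose wt (s : {ffun 'I_(rank D) -> 'I_3}) i : int := (s i)%:Z - 1.
pose P s := `[< exists v, [/\ U v, v != 0 & weight_vec (wt s) v] >].
have wtP mu v : v != 0 -> weight_vec mu v -> exists s, wt s = mu.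
  move=> vn0 Hv; exists [ffun i => inord (absz (mu i + 1))].
  apply: funext => i; rewrite /wt ffunE.
  have := tripotent_eig t vn0 (Hv i) => mi.
  by rewrite inordK; lia.
have [s0 s0E] := wtP _ _ v0n0 Hmu0.
have Ps0 : P s0 by apply/asboolP; exists v0; rewrite s0E.
have [s /asboolP[v [Uv vn0 Hv]] smax] :=
  @arg_maxP _ _ _ s0 P (fun s => height (wt s)) Ps0.
exists (wt s), v; split=> //; split=> // r r0; apply: contrapT => /eqP xv.
have Hx := weight_shift (fun i => cartan_root i r) Hv.
have [s' s'E] := wtP _ _ xv Hx.
have /smax : P s'.
  by apply/asboolP; exists (rho (X r) v); rewrite s'E; split=> //; case: Um => _ _; apply.
rewrite s'E /= /height; under eq_bigr do rewrite mulrDr.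
rewrite big_split /= -/(height (al r)) gerDl.
by rewrite leNgt r0.
Qed.

(* The vectors killed by a product of factors [rho h - t] with [t < c]. If [h]
   has eigenvalue [c] at a highest weight vector, they contain every proper
   descendant of that vector but not the vector itself. *)
Definition eig_op (h : L) (s : seq int) (y : V) : V :=
  foldr (fun t z => rho h z - t%:~R *: z) y s.

Definition below (h : L) (c : int) (y : V) :=
  exists2 s, all (fun t => t < c) s & eig_op h s y = 0.

Lemma eig_op_linear h s a y z :
  eig_op h s (a *: y + z) = a *: eig_op h s y + eig_op h s z.
Proof.
elim: s => //= t s IH; rewrite IH rep_linearr !scalerDr opprD !scalerA.
by rewrite scalerN scalerA addrACA [t%:~R * a]mulrC.
Qed.

Lemma eig_op0 h s : eig_op h s 0 = 0.
Proof. by elim: s => //= t s ->; rewrite rep0r scaler0 subrr. Qed.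

(** All factors are polynomials in one operator and hence commute; this makes [below] stable under
    sums. *)
Lemma eig_op_catC h s1 s2 y :
  eig_op h (s1 ++ s2) y = eig_op h s2 (eig_op h s1 y).
Proof.
elim: s2 y => [|t s2 IH] y; first by rewrite cats0.
have C s z : eig_op h s (rho h z - t%:~R *: z) =
    rho h (eig_op h s z) - t%:~R *: eig_op h s z.
  elim: s => //= u s ->.
  rewrite !rep_subr !rep_scaler !scalerBr !scalerA [u%:~R * _]mulrC !opprB.
  by rewrite -!addrA; congr (_ + _); rewrite addrCA [RHS]addrCA [X in _ = _ + X]addrC.
rewrite /= -IH /eig_op foldr_cat /= -/(eig_op h s2 y).
rewrite -/(eig_op h s1 _) C -/(eig_op h (s1 ++ s2) y).
by rewrite /eig_op foldr_cat.
Qed.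

Lemma below_linear h c a y z :
  below h c y -> below h c z -> below h c (a *: y + z).
Proof.
move=> [s sc sy] [s' sc' sz]; exists (s ++ s'); first by rewrite all_cat sc.
rewrite eig_op_linear eig_op_catC sy eig_op0 scaler0 add0r.
by rewrite /eig_op foldr_cat -!/(eig_op _ _ _) sz eig_op0.
Qed.

Lemma below0 h c : below h c 0.
Proof. by exists [::]. Qed.

(** Moving [f] past a factor turns its root t into t + k, which stays smaller than [c]. *)
Lemma below_lower h c f k y : lie h f = (k%:~R : K) *: f -> k <= 0 ->
  below h c y -> below h c (rho f y).
Proof.
move=> hf k0 [s sc sy]; exists [seq t + k | t <- s].
  by rewrite all_map; apply: sub_all sc => t /= tc; lia.
suff -> : eig_op h [seq t + k | t <- s] (rho f y) = rho f (eig_op h s y).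
  by rewrite sy rep0r.
elim: s {sc sy} => //= t s ->.
rewrite rep_swap hf rep_scalel rep_subr rep_scaler /= intrD scalerDl.
by rewrite opprD addrACA subrr addr0.
Qed.

Lemma below_eig h c f k y : lie h f = (k%:~R : K) *: f -> k < 0 ->
  rho h y = (c%:~R : K) *: y -> below h c (rho f y).
Proof.
move=> hf k0 hy; exists [:: c + k]; first by rewrite /= andbT; lia.
by rewrite /= rep_swap hf hy rep_scalel rep_scaler -scalerDl -intrD subrr.
Qed.

Lemma not_below h c y : y != 0 -> rho h y = (c%:~R : K) *: y -> ~ below h c y.
Proof.
move=> yn0 hy [s sc /eqP]; apply/negP.
have -> : eig_op h s y = (\prod_(t <- s) (c - t)%:~R) *: y.
  elim: s {sc} => [|t s /= ->]; first by rewrite big_nil scale1r.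
  rewrite big_cons rep_scaler hy !scalerA -scalerBl; congr (_ *: _).
  by rewrite intrB mulrBl mulrC.
rewrite scaler_eq0 (negPf yn0) orbF prodf_seq_neq0.
by apply: sub_all sc => t tc; rewrite /= intr_eq0 subr_eq0 gt_eqF.
Qed.

End Rep.

(** The grading element: its eigenvalues on weight vectors are the heights. *)
Definition cartan_sum : L := \sum_i (level i)%:~R *: H i.

Lemma cartan_sum_root r :
  lie cartan_sum (X r) = (height (al r))%:~R *: X r.
Proof.
have l0 : lie 0 (X r) = 0.
  by have := lie_linearl (-1) 0 0 (X r); rewrite scaler0 scaleN1r addNr add0r.
rewrite /cartan_sum /height rmorph_sum scaler_suml /=.
elim: (index_enum _) => [|i s IH]; first by rewrite !big_nil l0.
by rewrite !big_cons lie_linearl IH cartan_root scalerA -intrM.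
Qed.

Lemma cartan_sum_eig (V : lmodType K) (rho : rep L V) mu v :
  weight_vec rho mu v -> rho cartan_sum v = (height mu)%:~R *: v.
Proof.
move=> Hv; rewrite rep_suml /height rmorph_sum scaler_suml.
by apply: eq_bigr => i _; rewrite rep_scalel Hv scalerA -intrM.
Qed.

(** * Uniqueness of the irreducible module with a given highest weight *)

Section Uniqueness.
Variables (V W : lmodType K) (rho : rep L V) (sigma : rep L W).
Variables (mu : weight) (v : V) (w : W).
Hypotheses (rho_irr : irreducible_rep rho) (sigma_irr : irreducible_rep sigma).
Hypotheses (vn0 : v != 0) (wn0 : w != 0).
Hypotheses (v_hw : is_hw rho mu v) (w_hw : is_hw sigma mu w).

(** Generation uses only root vectors of negative height, which is what makes the induction in
    [hw_graph_below] work; stability under the whole algebra is then proved in [hw_graph_act]. *)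
Inductive hw_graph : V -> W -> Prop :=
| hw_graph0 : hw_graph 0 0
| hw_graph_hw : hw_graph v w
| hw_graph_linear a x y x' y' :
    hw_graph x y -> hw_graph x' y' -> hw_graph (a *: x + x') (a *: y + y')
| hw_graph_lower r x y : height (al r) < 0 ->
    hw_graph x y -> hw_graph (rho (X r) x) (sigma (X r) y).

Lemma hw_graphZ a x y : hw_graph x y -> hw_graph (a *: x) (a *: y).
Proof. by move=> xy; have := hw_graph_linear a xy hw_graph0; rewrite !addr0. Qed.

Lemma hw_graphD x y x' y' :
  hw_graph x y -> hw_graph x' y' -> hw_graph (x + x') (y + y').
Proof. by move=> h h'; have := hw_graph_linear 1 h h'; rewrite !scale1r. Qed.

Lemma hw_graph_act z x y : hw_graph x y -> hw_graph (rho z x) (sigma z y).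
Proof.
move=> xy; elim: xy z => {x y} [||a x y x' y' _ IH1 _ IH2|r x y r0 xy IH] z.
- by rewrite !rep0r; exact: hw_graph0.
- apply: (root_span (r0 := D) (P := fun z => hw_graph (rho z v) (sigma z w))).
  + by move=> a z1 z2 h1 h2; rewrite !rep_linearl; exact: hw_graph_linear.
  + by move=> i; case: v_hw w_hw => [-> _] [-> _]; apply: hw_graphZ; exact: hw_graph_hw.
  + move=> r; rewrite neq_lt => /orP[r0|r0].
      by apply: hw_graph_lower => //; exact: hw_graph_hw.
    case: v_hw w_hw => [_ hv] [_ hw]; rewrite hv // hw //; exact: hw_graph0.
  + by rewrite !rep0l; exact: hw_graph0.
- by rewrite !rep_linearr; exact: hw_graph_linear.
(* Commuting [z] past the lowering operator leaves a bracket term, to which the induction hypothesis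
   applies because it holds for every element of the algebra. *)
- rewrite rep_swap [sigma z _]rep_swap; apply: hw_graphD; last exact: IH.
  exact: hw_graph_lower.
Qed.

Let hts := height mu.

(** The point is that one [c] serves both components: modulo smaller eigenvalues the graph is the
    line through the pair of highest weight vectors. *)
Lemma hw_graph_below x y : hw_graph x y -> exists c,
  below rho cartan_sum hts (x - c *: v) /\ below sigma cartan_sum hts (y - c *: w).
Proof.
elim=> {x y} [||a x y x' y' _ [c [cx cy]] _ [c' [cx' cy']]|r x y r0 _ [c [cx cy]]].
- by exists 0; rewrite !scale0r !subr0; split; exact: below0.
- by exists 1; rewrite !scale1r !subrr; split; exact: below0.
- exists (a * c + c').
  have E (U : lmodType K) (u z z' : U) : a *: z + z' - (a * c + c') *: u =
      a *: (z - c *: u) + (z' - c' *: u).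
    by rewrite scalerDl scalerBr scalerA opprD addrACA.
  by rewrite !E; split; exact: below_linear.
- exists 0; rewrite !scale0r !subr0.
  have E (U : lmodType K) (tau : rep L U) u z : weight_vec tau mu u ->
      below tau cartan_sum hts (z - c *: u) ->
      below tau cartan_sum hts (tau (X r) z).
    move=> /cartan_sum_eig hu hz.
    rewrite -(subrK (c *: u) z) addrC rep_addr rep_scaler.
    apply: below_linear; first exact: below_eig (cartan_sum_root r) r0 hu.
    exact: below_lower (cartan_sum_root r) (ltW r0) hz.
  by case: v_hw w_hw => [hv _] [hw _]; split; [exact: E hv _|exact: E hw _].
Qed.

Lemma hw_graph_unique_r y : hw_graph 0 y -> y = 0.
Proof.
have [_ /(_ [set y | hw_graph 0 y]%classic)] := sigma_irr.
case.
- split=> [|a y1 y2 h1 h2|z y1 h1] /=; first exact: hw_graph0.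
    by have := hw_graph_linear a h1 h2; rewrite scaler0 addr0.
  by have := hw_graph_act z h1; rewrite rep0r.
- by move=> E h; have : [set 0]%classic y by rewrite -E.
(* The first component forces c = 0, and then the second would place [w] below its own
   eigenvalue. *)
move=> E; have /hw_graph_below[c [cv cw]] : hw_graph 0 w.
  by rewrite -[_ w]/([set y | hw_graph 0 y]%classic w) E.
have c0 : c = 0.
  apply: contrapT => /eqP cn0; apply: (not_below vn0 (cartan_sum_eig v_hw.1)).
  have := below_linear (- c^-1) cv (below0 _ _ _).
  by rewrite sub0r scaleNr scalerN opprK scalerA mulVf // scale1r addr0.
case: (not_below wn0 (cartan_sum_eig w_hw.1)).
by move: cw; rewrite c0 scale0r subr0.
Qed.

End Uniqueness.

Lemma hw_graphC (V W : lmodType K) (rho : rep L V) (sigma : rep L W) v w x y :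
  hw_graph rho sigma v w x y -> hw_graph sigma rho w v y x.
Proof.
elim=> {x y} [||a x y x' y' _ IH1 _ IH2|r x y r0 _ IH].
- exact: hw_graph0.
- exact: hw_graph_hw.
- exact: hw_graph_linear.
- exact: hw_graph_lower.
Qed.

Lemma hw_graph_total (V W : lmodType K) (rho : rep L V) (sigma : rep L W)
    mu v w : irreducible_rep rho -> v != 0 ->
  is_hw rho mu v -> is_hw sigma mu w ->
  forall x, exists y, hw_graph rho sigma v w x y.
Proof.
move=> [_ rho_irr] vn0 v_hw w_hw.
have [||E x] := rho_irr [set x | exists y, hw_graph rho sigma v w x y]%classic.
- split=> /= [|a x x' [y h] [y' h']|z x [y h]].
  + by exists 0; exact: hw_graph0.
  + by exists (a *: y + y'); exact: hw_graph_linear.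
  + by exists (sigma z y); exact: hw_graph_act v_hw w_hw _ _ _ h.
- move=> E; have : [set 0]%classic v.
    by rewrite -E; exists w; exact: hw_graph_hw.
  by move/eqP; rewrite (negPf vn0).
by have : [set: V]%classic x by []; rewrite -E.
Qed.

(* The submodule of [V * W] generated by the pair of highest weight vectors is
   the graph of an isomorphism: by irreducibility, otherwise it would contain
   [(0, w)] or [(v, 0)], whereas its part of weight [mu] is the line [K (v, w)]. *)
Theorem hw_iso (V W : lmodType K) (rho : rep L V) (sigma : rep L W) mu v w :
  irreducible_rep rho -> irreducible_rep sigma -> v != 0 -> w != 0 ->
  is_hw rho mu v -> is_hw sigma mu w -> rep_iso rho sigma.
Proof.
move=> irr_r irr_s vn0 wn0 v_hw w_hw.
have [f fP] := choice (hw_graph_total irr_r vn0 v_hw w_hw).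
have [g gP] := choice (hw_graph_total irr_s wn0 w_hw v_hw).
have func x y y' :
    hw_graph rho sigma v w x y -> hw_graph rho sigma v w x y' -> y = y'.
  move=> h h'; apply/eqP; rewrite -subr_eq0; apply/eqP.
  apply: (hw_graph_unique_r irr_s vn0 wn0 v_hw w_hw).
  by have := hw_graph_linear (-1) h' h; rewrite !scaleN1r addNr addrC.
have inj x x' y :
    hw_graph rho sigma v w x y -> hw_graph rho sigma v w x' y -> x = x'.
  move=> /hw_graphC h /hw_graphC h'; apply/eqP; rewrite -subr_eq0; apply/eqP.
  apply: (hw_graph_unique_r irr_r wn0 vn0 w_hw v_hw).
  by have := hw_graph_linear (-1) h' h; rewrite !scaleN1r addNr addrC.
have fl : linear f.
  by move=> a x y; apply: func (fP _) _; exact: hw_graph_linear.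
pose F : {linear V -> W} := HB.pack f (GRing.isLinear.Build _ _ _ _ f fl).
exists F => [|x y].
  exists g => x; first by apply: inj (fP x); apply/hw_graphC.
  by apply: func (fP _) _; apply/hw_graphC.
by apply: func (fP _) _; exact: hw_graph_act v_hw w_hw _ _ _ (fP y).
Qed.

End HighestWeight.

(** Take a subspace inside [P] of maximal dimension: any vector of [P] outside it could be adjoined.
    This gives submodules, which are mere sets, a dimension. *)
Lemma set_vspace (K : fieldType) (E : vectType K) (P : set E) :
  P 0 -> (forall a x y, P x -> P y -> P (a *: x + y)) ->
  exists S : {vspace E}, forall x, x \in S <-> P x.
Proof.
move=> P0 Pl.
pose Q k := `[< exists2 S : {vspace E}, \dim S = k & forall x, x \in S -> P x >].
have Q0 : exists k, Q k.
  exists 0%N; apply/asboolP; exists 0%VS; first exact: dimv0.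
  by move=> x; rewrite memv0 => /eqP->.
have Qb k : Q k -> (k <= \dim {:E})%N.
  by case/asboolP=> S <- _; apply: dimvS; exact: subvf.
have [k /asboolP[S dS SP] kmax] := ex_maxnP Q0 Qb.
exists S => x; split; first exact: SP.
move=> Px; apply: contrapT => /negP xS.
have /kmax : Q (\dim (<[x]> + S)).
  apply/asboolP; exists (<[x]> + S)%VS => // y /memv_addP[_ /vlineP[a ->] [z zS ->]].
  by apply: Pl => //; exact: SP.
rewrite -dS leqNgt => /negP; apply.
rewrite ltn_neqAle dimvS ?addvSr // andbT; apply: contra xS => dE.
suff -> : S = (<[x]> + S)%VS by apply: subvP (addvSl _ _) _ _; exact: memv_line.
by apply/eqP; rewrite eqEdim addvSr /= (eqP dE).
Qed.

(* A proper submodule [U] containing [w] would have a nonzero orthogonal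
   complement; being a submodule it also contains [w], so that [B w w = 0]. *)
Lemma form_irreducible (K : fieldType) (L : lieAlgType K) (W : vectType K)
    (rho : rep L W) (B : W -> W -> K) (tau : L -> L) (w : W) :
  (forall a x x' y, B (a *: x + x') y = a * B x y + B x' y) ->
  (forall x y, B x y = B y x) ->
  (forall z x y, B (rho z x) y = B x (rho (tau z) y)) ->
  B w w != 0 ->
  (forall U, submodule rho U -> (exists2 x, U x & x != 0) -> U w) ->
  irreducible_rep rho.
Proof.
move=> Bl Bs Bt Bww Uw.
have B0 y : B 0 y = 0.
  by have := Bl (-1) 0 0 y; rewrite scaler0 addr0 mulN1r addNr.
split.
  by exists w; apply: contraNneq Bww => ->; rewrite B0.
move=> U Um; case: (pselect (exists2 x, U x & x != 0)) => [Ux|nUx]; last first.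
  left; apply/seteqP; split=> x /=; last by move=> ->; case: Um.
  by move=> Ux; apply: contrapT => /eqP xn0; apply: nUx; exists x.
right; have Uw0 := Uw _ Um Ux.
have [U0 Ul UH] := Um; have [S SP] := set_vspace U0 Ul.
suff dS : (\dim {:W} <= \dim S)%N.
  have /eqP SE : S == fullv by rewrite eqEdim subvf.
  by apply/seteqP; split=> // x _; apply/SP; rewrite SE memvf.
rewrite leqNgt; apply/negP => dS.
(* Pairing with a basis of [S] maps [W] to a space of smaller dimension; the kernel is the
   orthogonal complement. *)
pose f (x : W) : 'rV[K]_(\dim S) := \row_i B x (vbasis S)`_i.
have fl : linear f by move=> a x y; apply/rowP => i; rewrite !mxE Bl.
pose F : {linear W -> 'rV[K]_(\dim S)} := HB.pack f (GRing.isLinear.Build _ _ _ _ f fl).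
have kern0 : lker (linfun F) != 0%VS.
  rewrite -dimv_eq0 -lt0n.
  have := limg_ker_dim (linfun F) fullv; rewrite capfv => dE.
  have : (\dim (linfun F @: fullv) <= \dim S)%N.
    by apply: leq_trans (dimvS (subvf _)) _; rewrite dimvf dim_matrix; lia.
  by lia.
pose x0 := vpick (lker (linfun F)).
have x0K : F x0 = 0 by apply/eqP; have := memv_pick (lker (linfun F)); rewrite memv_ker lfunE.
pose U' : set W := [set x | forall y, U y -> B x y = 0]%classic.
have : U' w.
  apply: Uw.
    split=> [y _|a x y hx hy z Uz|z x hx y Uy]; first exact: B0.
      by rewrite Bl hx // hy // mulr0 addr0.
    by rewrite Bt; apply: hx; exact: UH.
  exists x0; last by rewrite vpick0.
  move=> y /SP /coord_vbasis ->; rewrite Bs.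
  elim/big_rec: _ => [|i u _ hu]; first exact: B0.
  rewrite Bl hu addr0 Bs.
  by have /rowP/(_ i) := x0K; rewrite !mxE => ->; rewrite mulr0.
by move=> /(_ w Uw0) /eqP; rewrite (negPf Bww).
Qed.

(** * Exterior powers as alternating tensors *)

Section ExtCoord.
Variables (K : fieldType) (N p : nat).
Implicit Types (f : 'I_p -> 'I_N) (w : extpow K N p) (v : 'I_p -> 'cV[K]_N).

Definition minor_det f v : K^o := \det (\matrix_(i < p, j < p) v i (f j) 0).

(* The coordinate of [w], seen as an alternating tensor, at the index tuple [f]. *)
Definition ext_coord f w : K^o := ext_lift (minor_det f) w.

Lemma minor_det_multilinear f : multilinear (minor_det f).
Proof.
move=> v i a x y; rewrite /minor_det -[RHS]/(a * _ + _).
rewrite -[X in _ = _ + X]mul1r; apply: (determinant_multilinear (i0 := i)).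
- by apply/rowP => j; rewrite !mxE !updE !mxE mul1r.
- by apply/matrixP => k j; rewrite !mxE !updNE // eq_sym neq_lift.
- by apply/matrixP => k j; rewrite !mxE !updNE // eq_sym neq_lift.
Qed.

Lemma minor_det_alternating f : alternating (minor_det f).
Proof.
move=> v i j ij vij; apply: (determinant_alternate ij) => k.
by rewrite !mxE vij.
Qed.

Lemma ext_coord_linear f : linear (ext_coord f).
Proof. exact: ext_lift_linear. Qed.

HB.instance Definition _ f :=
  GRing.isLinear.Build K _ _ _ (ext_coord f) (ext_coord_linear f).

Lemma ext_coord_wedge f v : ext_coord f (wedge v) = minor_det f v.
Proof.
exact: (ext_lift_wedge (@minor_det_multilinear f) (@minor_det_alternating f)).
Qed.

Lemma ext_coord_psub (S : psubset N p) w : ext_coord (psub_elt S) w = w S.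
Proof.
suff: ext_coord (psub_elt S) =1 (fun w => w S : K^o) by apply.
apply: extpow_ind_linear.
- exact: ext_coord_linear.
- by move=> a x y; rewrite !ffunE.
by move=> v; rewrite ext_coord_wedge ffunE.
Qed.

Lemma ext_coord_perm f (s : 'S_p) w :
  ext_coord (f \o s) w = (-1) ^+ s * ext_coord f w.
Proof.
rewrite /ext_coord /ext_lift big_distrr /=; apply: eq_bigr => S _.
rewrite -[RHS]/((-1) ^+ s * (w S * _)) mulrCA; congr (_ * _).
rewrite -odd_permV -det_perm mulrC /minor_det -det_mulmx -col_permE.
by congr (\det _); apply/matrixP => i j; rewrite !mxE.
Qed.

Lemma ext_coord_alt f i j w : i != j -> f i = f j -> ext_coord f w = 0.
Proof.
move=> ij fij; rewrite /ext_coord /ext_lift big1 // => S _.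
rewrite /minor_det -det_tr (determinant_alternate ij) ?scaler0 // => k.
by rewrite !mxE fij.
Qed.

Lemma ext_coord_inj f w : ext_coord f w != 0 -> injective f.
Proof.
move=> fw i j fij; apply/eqP; apply: contraNT fw => ij.
by rewrite (ext_coord_alt _ ij fij).
Qed.

(** [f] differs from the increasing enumeration of [S] by a permutation, whose sign does not depend
    on [w]. *)
Lemma ext_coord_image f (S : psubset N p) : injective f ->
  (forall i, f i \in val S) ->
  exists b : bool, forall w, ext_coord f w = (-1) ^+ b * w S.
Proof.
move=> f_inj fS.
have h i : exists j, psub_elt S j == f i.
  by have [j <-] := psub_elt_surj (fS i); exists j.
pose s0 i := xchoose (h i).
have s0E i : psub_elt S (s0 i) = f i by exact: (eqP (xchooseP (h i))).
have s0_inj : injective s0 by move=> i j ij; apply: f_inj; rewrite -!s0E ij.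
exists (perm s0_inj) => w; rewrite -ext_coord_psub -ext_coord_perm.
by congr (ext_coord _ w); apply: funext => i /=; rewrite permE s0E.
Qed.

(** Both sides are the derivative of det (M + t M') at t = 0, computed by rows and by columns. *)
Lemma det_upd_sum (M M' : 'M[K]_p) :
  \sum_i \det (\matrix_(k, l) (if k == i then M' else M) k l) =
  \sum_j \det (\matrix_(k, l) (if l == j then M' else M) k l).
Proof.
transitivity (\sum_i \sum_j M' i j * cofactor M i j).
  apply: eq_bigr => i _; rewrite (expand_det_row _ i); apply: eq_bigr => j _.
  rewrite mxE eqxx; congr (_ * (_ * \det _)); apply/matrixP => k l; rewrite !mxE.
  by rewrite eq_sym (negPf (neq_lift _ _)).
rewrite exchange_big; apply: eq_bigr => j _; rewrite (expand_det_col _ j).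
apply: eq_bigr => i _.
rewrite mxE eqxx; congr (_ * (_ * \det _)); apply/matrixP => k l; rewrite !mxE.
by rewrite [_ == j]eq_sym (negPf (neq_lift _ _)).
Qed.

(** [A] acts on the vectors, which are the rows of a minor, whereas the right-hand side changes the
    indices, its columns; [det_upd_sum] trades one for the other. In this form no signs and no
    reordering occur. *)
Lemma ext_coord_act f A w : ext_coord f (ext_act A w) =
  \sum_i \sum_k A (f i) k * ext_coord (upd f i k) w.
Proof.
pose g w : K^o := \sum_i \sum_k A (f i) k * ext_coord (upd f i k) w.
suff: ext_coord f \o ext_act A =1 g by apply.
apply: extpow_ind_linear => [a x y|a x y|v]; rewrite /g /=.
- by rewrite ext_act_linear ext_coord_linear.
- rewrite scaler_sumr -big_split /=; apply: eq_bigr => i _.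
  rewrite scaler_sumr -big_split /=; apply: eq_bigr => k _.
  by rewrite ext_coord_linear -![a *: _]/(a * _); ring.
rewrite ext_act_wedge (linear_sum (ext_coord f)) /=.
under eq_bigr do rewrite ext_coord_wedge.
transitivity (\sum_i \det (\matrix_(k, l) (if k == i then
    \matrix_(k, l) (A *m v k) (f l) 0 else \matrix_(k, l) v k (f l) 0) k l)).
  apply: eq_bigr => i _; congr (\det _); apply/matrixP => k l; rewrite !mxE /upd.
  by case: (k =P i) => [->|_]; rewrite !mxE.
rewrite det_upd_sum; apply: eq_bigr => j _; rewrite (expand_det_col _ j).
under [RHS]eq_bigr do rewrite ext_coord_wedge /minor_det (expand_det_col _ j) mulr_sumr.
rewrite exchange_big; apply: eq_bigr => i _; rewrite !mxE eqxx !mxE mulr_suml.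
apply: eq_bigr => k _; rewrite !mxE updE -[LHS]mulrA; congr (_ * (_ * (_ * \det _))).
apply/matrixP => k' l; rewrite !mxE eq_sym (negPf (neq_lift _ _)) !mxE.
by rewrite updNE // eq_sym neq_lift.
Qed.

Lemma ext_act_diag (d : 'rV[K]_N) w S :
  ext_act (diag_mx d) w S = (\sum_(a in val S) d 0 a) * w S.
Proof.
rewrite -[LHS]ext_coord_psub ext_coord_act.
transitivity (\sum_i d 0 (psub_elt S i) * w S).
  apply: eq_bigr => i _; rewrite (bigD1 (psub_elt S i)) //= big1 ?addr0 => [|k ki].
    by rewrite mxE eqxx upd_id ext_coord_psub.
  by rewrite mxE eq_sym (negPf ki) mul0r.
rewrite -mulr_suml; congr (_ * _).
rewrite [RHS]big_enum_val; pose h := cast_ord (eqP (valP S)).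
rewrite (reindex h) /=.
  by apply: eq_bigr => i _; congr (d 0 (enum_val _)); exact: val_inj.
by exists (cast_ord (esym (eqP (valP S)))) => i _; exact: val_inj.
Qed.

End ExtCoord.

Section ExtBasis.
Variables (K : fieldType) (N p : nat).

Definition ext_basis (S : psubset N p) : extpow K N p := [ffun T => (T == S)%:R].

Lemma ext_coord_basis f S : ext_coord f (ext_basis S) != 0 ->
  injective f /\ forall i, f i \in val S.
Proof.
move=> fS; have f_inj := ext_coord_inj fS; split=> // i.
have cT : #|[set f i | i : 'I_p]| == p by rewrite card_imset // card_ord.
pose T : psubset N p := Sub [set f i | i : 'I_p] cT.
have fT j : f j \in val T by exact: imset_f.
have [b /(_ (ext_basis S)) E] := ext_coord_image K f_inj fT.
move: fS; rewrite E ffunE; case: (T =P S) => [<- _|_]; last by rewrite mulr0 eqxx.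
exact: fT.
Qed.

Lemma ext_coord_basis_sqr f S :
  ext_coord f (ext_basis S) * ext_coord f (ext_basis S) =
  (ext_coord f (ext_basis S) != 0)%:R.
Proof.
case: eqP => [->|/eqP fS]; first by rewrite mul0r.
have [f_inj fiS] := ext_coord_basis fS.
have [b /(_ (ext_basis S)) ->] := ext_coord_image K f_inj fiS.
by rewrite ffunE eqxx mulr1 -expr2 sqrr_sign.
Qed.

(** A non-zero coordinate would come from an enumeration of [S] with [b] put in the place of [a].
    Then [b], hence [a], lies in [S], so that [a] already occurs at another place of [T]. *)
Lemma ext_act_delta_basis (a b : 'I_N) (S : psubset N p) : a != b ->
  (b \in val S -> a \in val S) -> ext_act (delta_mx a b) (ext_basis S) = 0.
Proof.
move=> ab baS; apply/ffunP => T; rewrite -[LHS]ext_coord_psub ext_coord_act ffunE.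
rewrite big1 // => i _; rewrite big1 // => k _; rewrite mxE.
case: eqP => [ia|_]; last by rewrite mul0r.
case: eqP => [->|_]; last by rewrite mul0r.
rewrite mul1r; apply/eqP; apply: contraT => /ext_coord_basis[u_inj uS].
have bS : b \in val S by have := uS i; rewrite updE.
have [j ja] : exists j, upd (psub_elt T) i b j = a.
  have uT : [set upd (psub_elt T) i b j | j : 'I_p] = val S.
    apply/eqP; rewrite eqEcard; apply/andP; split.
      by apply/fintype.subsetP => _ /imsetP[j _ ->].
    by rewrite card_imset // card_ord (eqP (valP S)).
  by have := baS bS; rewrite -uT => /imsetP[j _ ->]; exists j.
move: ja; case: (eqVneq j i) => [->|ji].
  by rewrite updE => ba; rewrite -ba eqxx in ab.
by rewrite updNE // -ia => /psub_elt_inj E; rewrite E eqxx in ji.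
Qed.

Lemma ext_basis_span (w : extpow K N p) S :
  (forall T, w T != 0 -> T = S) -> w = w S *: ext_basis S.
Proof.
move=> wS; apply/ffunP => T; rewrite !ffunE.
case: (eqVneq T S) => [->|TS]; first by rewrite -[RHS]/(_ * _) mulr1.
rewrite scaler0; apply/eqP; apply: contraNT TS => /wS ->; exact: eqxx.
Qed.

(** The image of [A] is spanned by [r], so the terms where [A] acts at two different places contain
    [r] twice and vanish. There remain those where it acts twice at one place, and A^2 = tr(A) A. *)
Lemma ext_act_rank1 (r u : 'cV[K]_N) (w : extpow K N p) :
  ext_act (r *m u^T) (ext_act (r *m u^T) w) =
  \tr (r *m u^T) *: ext_act (r *m u^T) w.
Proof.
set A := r *m u^T.
have Av (v : 'cV[K]_N) : A *m v = (u^T *m v) 0 0 *: r.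
  by rewrite /A -mulmxA -mul_mx_scalar -mx11_scalar.
have AA (v : 'cV[K]_N) : A *m (A *m v) = \tr A *: (A *m v).
  rewrite [A *m v]Av -scalemxAr Av !scalerA mulrC.
  by rewrite /A mxtrace_mulC trace_mx11.
suff: @ext_act K N p A \o ext_act A =1 (fun w => \tr A *: ext_act A w) by move/(_ w).
apply: extpow_ind_linear => [a x y|a x y|v] /=.
- by rewrite !ext_act_linear.
- by rewrite !ext_act_linear scalerDr !scalerA mulrC.
rewrite !ext_act_wedge (linear_sum (@ext_act K N p A)) scaler_sumr /=.
apply: eq_bigr => i _; rewrite ext_act_wedge (bigD1 i) //= big1 ?addr0.
  by rewrite upd_upd updE AA (mlZ (@wedge_multilinear K N p)).
move=> j ji; rewrite updNE // !Av (mlZ (@wedge_multilinear K N p)).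
rewrite -updC // (mlZ (@wedge_multilinear K N p)).
rewrite (@wedge_alternating K N p _ i j) ?scaler0 //; first by rewrite eq_sym.
by rewrite updE updNE ?updE // eq_sym.
Qed.

End ExtBasis.

Section ExtForm.
Variables (K : numFieldType) (N p : nat).
Implicit Types x y : extpow K N p.

(* Summing over all index tuples, rather than over subsets, makes the form
   [p!] times the standard one, and its contravariance a mere reindexing. *)
Definition ext_form x y : K :=
  \sum_(f : {ffun 'I_p -> 'I_N}) ext_coord f x * ext_coord f y.

Lemma ext_form_linear a x x' y :
  ext_form (a *: x + x') y = a * ext_form x y + ext_form x' y.
Proof.
rewrite /ext_form mulr_sumr -big_split; apply: eq_bigr => f _ /=.
by rewrite ext_coord_linear mulrDl mulrA.
Qed.

Lemma ext_formC x y : ext_form x y = ext_form y x.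
Proof. by apply: eq_bigr => f _; rewrite mulrC. Qed.

Lemma ext_form_tr A x y :
  ext_form (ext_act A x) y = ext_form x (ext_act A^T y).
Proof.
transitivity (\sum_i \sum_(u : {ffun 'I_p -> 'I_N} * 'I_N)
    A (u.1 i) u.2 * ext_coord (upd u.1 i u.2) x * ext_coord u.1 y).
  rewrite /ext_form; under eq_bigr do rewrite ext_coord_act mulr_suml.
  rewrite exchange_big; apply: eq_bigr => i _ /=.
  rewrite -(pair_bigA _ (fun (f : {ffun _}) k =>
    A (f i) k * ext_coord (upd f i k) x * ext_coord f y)) /=.
  by apply: eq_bigr => f _; rewrite mulr_suml.
transitivity (\sum_i \sum_(u : {ffun 'I_p -> 'I_N} * 'I_N)
    ext_coord u.1 x * (A u.2 (u.1 i) * ext_coord (upd u.1 i u.2) y)); last first.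
  rewrite /ext_form; under [RHS]eq_bigr do rewrite ext_coord_act mulr_sumr.
  rewrite [RHS]exchange_big; apply: eq_bigr => i _ /=.
  rewrite -(pair_bigA _ (fun (f : {ffun _}) k =>
    ext_coord f x * (A k (f i) * ext_coord (upd f i k) y))) /=.
  apply: eq_bigr => f _; rewrite mulr_sumr.
  by apply: eq_bigr => k _; rewrite mxE.
apply: eq_bigr => i _.
(* Exchanging the new value with the entry that it replaces is an involution matching the terms of
   the two sums. *)
pose h (u : {ffun 'I_p -> 'I_N} * 'I_N) := ([ffun j => upd u.1 i u.2 j], u.1 i).
have hK : involutive h.
  case=> f k; rewrite /h /= ffunE updE; congr (_, _).
  by apply/ffunP => j; rewrite !ffunE /upd; case: eqP => [->|ji] //; rewrite ffunE; case: eqP.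
rewrite (reindex_inj (inv_inj hK)); apply: eq_bigr => -[f k] _ /=.
have E : [ffun j => upd f i k j] = upd f i k :> ('I_p -> 'I_N).
  by apply: funext => j; rewrite ffunE.
by rewrite E updE upd_upd upd_id mulrA [_ * A _ _]mulrC.
Qed.

Lemma ext_form_basis S : ext_form (ext_basis K S) (ext_basis K S) != 0.
Proof.
rewrite gt_eqF // /ext_form.
under eq_bigr do rewrite ext_coord_basis_sqr.
pose f0 : {ffun 'I_p -> 'I_N} := [ffun i => psub_elt S i].
have E : f0 = psub_elt S :> ('I_p -> 'I_N).
  by apply: funext => i; rewrite ffunE.
rewrite (bigD1 f0) //= E ext_coord_psub ffunE eqxx oner_neq0.
by rewrite ltr_wpDr ?ltr01 //; apply: sumr_ge0 => f _; exact: ler0n.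
Qed.

End ExtForm.

(** * Root data of the classical algebras *)

Section MatrixRootData.
Variables (K : numFieldType) (N : nat) (g : mxLie K N).

(** A projection, total and linear, so that it applies to any matrix; it inverts [val] only on
    members of [g]. *)
Definition mxelt (A : 'M[K]_N) : mxlie_alg g := vsproj (mxlie_space g) A.

Lemma mxeltK A : A \in mxlie_space g -> val (mxelt A) = A.
Proof. exact: vsprojK. Qed.

Lemma val_mxelt (x : mxlie_alg g) : mxelt (val x) = x.
Proof. exact: vsvalK. Qed.

Lemma mxelt_linear a A B : mxelt (a *: A + B) = a *: mxelt A + mxelt B.
Proof. exact: linearP. Qed.

Lemma mxelt_lie A B : A \in mxlie_space g -> B \in mxlie_space g ->
  lie (mxelt A) (mxelt B) = mxelt (A *m B - B *m A).
Proof.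
move=> Ag Bg; apply: val_inj.
by rewrite mxeltK ?mxlie_closed //= -!/(val (mxelt _)) !mxeltK.
Qed.

Variables (m : nat) (eps : 'I_m -> 'I_N -> int) (lev : 'I_m -> int).
Variables (X : 'I_N -> 'I_N -> 'M[K]_N) (c : K).

Definition cartan_mx i : 'M[K]_N := diag_mx (\row_a (eps i a)%:~R).

Hypothesis cartan_g : forall i, cartan_mx i \in mxlie_space g.
Hypothesis X_g : forall a b, X a b \in mxlie_space g.
Hypothesis X_weight : forall i a b a' b', X a b a' b' != 0 ->
  eps i a' - eps i b' = eps i a - eps i b.
Hypothesis X_span : forall A, A \in mxlie_space g ->
  A = c *: \sum_a \sum_b A a b *: X a b.
Hypothesis X_diag : forall a, exists k : 'I_m -> K, X a a = \sum_i k i *: cartan_mx i.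
Hypothesis X_ht : forall a b, a != b -> \sum_i lev i * (eps i a - eps i b) != 0.

Lemma mx_cartanC i j : lie (mxelt (cartan_mx i)) (mxelt (cartan_mx j)) = 0.
Proof. by rewrite mxelt_lie // /cartan_mx diag_mxC subrr /mxelt linear0. Qed.

Lemma mx_cartan_root i (r : 'I_N * 'I_N) :
  lie (mxelt (cartan_mx i)) (mxelt (X r.1 r.2)) =
  (eps i r.1 - eps i r.2)%:~R *: mxelt (X r.1 r.2).
Proof.
rewrite mxelt_lie // -[RHS]linearZ_LR; congr (mxelt _); apply/matrixP => a b.
rewrite /cartan_mx mul_diag_mx mul_mx_diag !mxE.
case: (eqVneq (X r.1 r.2 a b) 0) => [->|/X_weight <-].
  by rewrite mulr0 mul0r mulr0 subrr.
by rewrite intrB mulrBl [X _ _ _ _ * _]mulrC.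
Qed.

Lemma mx_root_span (P : mxlie_alg g -> Prop) :
  (forall a x y, P x -> P y -> P (a *: x + y)) ->
  (forall i, P (mxelt (cartan_mx i))) ->
  (forall r : 'I_N * 'I_N,
    \sum_i lev i * (eps i r.1 - eps i r.2) != 0 -> P (mxelt (X r.1 r.2))) ->
  P 0 -> forall x, P x.
Proof.
move=> Pl PH PX P0 x.
have Psum (I : Type) (s : seq I) (k : I -> K) F : (forall i, P (mxelt (F i))) ->
    P (mxelt (\sum_(i <- s) k i *: F i)).
  move=> PF; elim: s => [|i s IH]; first by rewrite big_nil /mxelt linear0.
  by rewrite big_cons mxelt_linear; exact: Pl.
rewrite -(val_mxelt x) (X_span (valP x)).
rewrite -[_ *: _]addr0 mxelt_linear; apply: Pl; last by rewrite /mxelt linear0.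
under eq_bigr do rewrite -[\sum_b _]scale1r.
apply: (Psum) => a; apply: (Psum) => b.
have [<-|ab] := eqVneq a b; last exact: (PX (a, b) (X_ht ab)).
by have [k ->] := X_diag a; exact: Psum.
Qed.

(** Roots are indexed by all pairs (a, b). Diagonal pairs have height zero, and [X_diag] recovers
    their vectors from the Cartan elements; distinct pairs may give the same vector up to sign, as
    for sp_2n. *)
Definition mx_root_data : root_data (mxlie_alg g) :=
  RootData mx_cartanC mx_cartan_root mx_root_span.

End MatrixRootData.

Section TypeA.
Variables (K : numFieldType).

Definition gl_eps N (i a : 'I_N) : int := (a == i)%:Z.
Definition glsl_level N (i : 'I_N) : int := - i%:Z.

Lemma mxtrace_delta N (a b : 'I_N) : \tr (delta_mx a b : 'M[K]_N) = (a == b)%:R.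
Proof.
rewrite /mxtrace (bigD1 a) //= mxE eqxx big1 ?addr0 // => i /negPf ia.
by rewrite mxE ia.
Qed.

Section GL.
Variable N : nat.
Let X (a b : 'I_N) : 'M[K]_N := delta_mx a b.

Lemma sum_level_eps (lev : 'I_N -> int) a : \sum_i lev i * gl_eps i a = lev a.
Proof.
rewrite (bigD1 a) //= /gl_eps eqxx mulr1 big1 ?addr0 // => i ia.
by rewrite eq_sym (negPf ia) mulr0.
Qed.

Lemma gl_cartan_mx i : cartan_mx K (@gl_eps N) i = delta_mx i i.
Proof.
apply/matrixP => a b; rewrite !mxE /gl_eps.
have [<-|ab] := eqVneq a b; first by rewrite mulr1n andbb; case: eqP.
rewrite mulr0n; case: (a =P i) => [ai|//]; case: (b =P i) => [bi|//].
by rewrite ai bi eqxx in ab.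
Qed.

Fact gl_cartan_mem i : cartan_mx K (@gl_eps N) i \in mxlie_space (gl K N).
Proof. exact: memvf. Qed.

Fact gl_X_mem a b : X a b \in mxlie_space (gl K N).
Proof. exact: memvf. Qed.

Fact gl_X_weight (i a b a' b' : 'I_N) : X a b a' b' != 0 ->
  gl_eps i a' - gl_eps i b' = gl_eps i a - gl_eps i b.
Proof. by rewrite mxE; case: (_ =P a) => [->|]; case: (_ =P b) => [->|]; rewrite ?eqxx. Qed.

Fact gl_X_span A : A \in mxlie_space (gl K N) ->
  A = 1 *: \sum_a \sum_b A a b *: X a b.
Proof. by move=> _; rewrite scale1r -matrix_sum_delta. Qed.

Fact gl_X_diag a : exists k : 'I_N -> K,
  X a a = \sum_i k i *: cartan_mx K (@gl_eps N) i.
Proof.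
exists (fun i => (i == a)%:R); rewrite (bigD1 a) //= eqxx scale1r big1.
  by rewrite addr0 gl_cartan_mx.
by move=> i /negPf ->; rewrite scale0r.
Qed.

Fact gl_X_ht (a b : 'I_N) : a != b ->
  \sum_i glsl_level i * (gl_eps i a - gl_eps i b) != 0.
Proof.
move=> ab; under eq_bigr do rewrite mulrBr.
rewrite sumrB !sum_level_eps /glsl_level.
by apply: contraNneq ab => h; apply/eqP/val_inj => /=; lia.
Qed.

Definition gl_root_data : root_data (mxlie_alg (gl K N)) :=
  mx_root_data gl_cartan_mem gl_X_mem gl_X_weight gl_X_span gl_X_diag gl_X_ht.

End GL.

Section SL.
Variable N : nat.
Let X (a b : 'I_N.+1) : 'M[K]_N.+1 :=
  if a == b then delta_mx a a - delta_mx 0 0 else delta_mx a b.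

(** The index i = 0 is kept although its Cartan element is zero: weights remain functions on all
    indices, normalized to vanish at 0. *)
Definition sl_eps (i a : 'I_N.+1) : int := (a == i)%:Z - (a == 0)%:Z.

Lemma sl_cartan_mx i : cartan_mx K sl_eps i = delta_mx i i - delta_mx 0 0.
Proof.
rewrite -!gl_cartan_mx; apply/matrixP => a b; rewrite !mxE /sl_eps /gl_eps.
by rewrite intrB mulrnBl.
Qed.

Lemma sl_mem_diag i : delta_mx i i - delta_mx 0 0 \in mxlie_space (sl K N.+1).
Proof. by rewrite mem_sl linearB /= !mxtrace_delta !eqxx subrr. Qed.

Lemma sl_mem_delta a b : a != b -> delta_mx a b \in mxlie_space (sl K N.+1).
Proof. by move=> ab; rewrite mem_sl mxtrace_delta (negPf ab). Qed.

Fact sl_cartan_mem i : cartan_mx K sl_eps i \in mxlie_space (sl K N.+1).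
Proof. by rewrite sl_cartan_mx sl_mem_diag. Qed.

Fact sl_X_mem a b : X a b \in mxlie_space (sl K N.+1).
Proof.
by rewrite /X; case: eqVneq => [_|ab]; [exact: sl_mem_diag|exact: sl_mem_delta].
Qed.

Fact sl_X_weight i a b a' b' : X a b a' b' != 0 ->
  sl_eps i a' - sl_eps i b' = sl_eps i a - sl_eps i b.
Proof.
rewrite /X; case: (a =P b) => [<-|_]; rewrite !mxE.
  rewrite !subrr; case: (eqVneq a' b') => [->|n]; first by rewrite subrr.
  have -> : (a' == a) && (b' == a) = false.
    by apply/negP => /andP[/eqP E /eqP E']; rewrite E E' eqxx in n.
  have -> : (a' == 0) && (b' == 0) = false.
    by apply/negP => /andP[/eqP E /eqP E']; rewrite E E' eqxx in n.
  by rewrite subrr eqxx.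
by case: (_ =P a) => [->|]; case: (_ =P b) => [->|]; rewrite ?eqxx.
Qed.

Fact sl_X_span A : A \in mxlie_space (sl K N.+1) ->
  A = 1 *: \sum_a \sum_b A a b *: X a b.
Proof.
rewrite mem_sl scale1r => /eqP trA.
(* Subtracting the zero matrix tr(A) E_00 turns each diagonal unit E_aa into E_aa - E_00. *)
transitivity (\sum_a \sum_b A a b *: delta_mx a b - \tr A *: delta_mx 0 0 : 'M[K]_N.+1).
  by rewrite trA scale0r subr0 -matrix_sum_delta.
rewrite /mxtrace scaler_suml -sumrB; apply: eq_bigr => a _.
rewrite (bigD1 a) //= [RHS](bigD1 a) //= /X eqxx addrAC -scalerBr; congr (_ + _).
by apply: eq_bigr => b ba; rewrite eq_sym (negPf ba).
Qed.

Fact sl_X_diag a : exists k : 'I_N.+1 -> K,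
  X a a = \sum_i k i *: cartan_mx K sl_eps i.
Proof.
exists (fun i => (i == a)%:R); rewrite (bigD1 a) //= eqxx scale1r big1.
  by rewrite addr0 sl_cartan_mx /X eqxx.
by move=> i /negPf ->; rewrite scale0r.
Qed.

(** The term -E_00 of each Cartan element adds the sum [t] of all indices if a = 0 and subtracts it
    if b = 0. As [t] is non-negative, the sign of the height is still that of b - a. *)
Lemma sl_height (a b : 'I_N.+1) :
  exists t : nat, \sum_i glsl_level i * (sl_eps i a - sl_eps i b) =
  b%:Z - a%:Z + ((a == 0)%:Z - (b == 0)%:Z) * t%:Z.
Proof.
exists (\sum_(i < N.+1) i)%N.
rewrite (eq_bigr (fun i => glsl_level i * gl_eps i a - glsl_level i * gl_eps i b
   + ((a == 0)%:Z - (b == 0)%:Z) * (i%:Z))); last first.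
  by move=> i _; rewrite /glsl_level /sl_eps /gl_eps; ring.
rewrite big_split /= sumrB !sum_level_eps -mulr_sumr /glsl_level.
congr (_ + _ * _); first by rewrite opprK addrC.
by elim/big_ind2: _ => // x1 x2 y1 y2 -> ->.
Qed.

Fact sl_X_ht a b : a != b ->
  \sum_i glsl_level i * (sl_eps i a - sl_eps i b) != 0.
Proof.
move=> ab; have [t ->] := sl_height a b.
have : (a : nat) != b by apply: contra ab => /eqP E; apply/eqP/val_inj.
by rewrite -!val_eqE /=; case: (nat_of_ord a) => [|a']; case: (nat_of_ord b) => [|b'] /=; lia.
Qed.

Definition sl_root_data : root_data (mxlie_alg (sl K N.+1)) :=
  mx_root_data sl_cartan_mem sl_X_mem sl_X_weight sl_X_span sl_X_diag sl_X_ht.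

End SL.
End TypeA.

Section TypeC.
Variables (K : numFieldType) (n : nat).
Implicit Types a b : 'I_(n + n).

Definition sp_conj a : 'I_(n + n) :=
  match split a with inl i => rshift n i | inr i => lshift n i end.
Definition sp_sign a : K := match split a with inl _ => 1 | inr _ => -1 end.
Definition sp_eps (i : 'I_n) a : int := (a == lshift n i)%:Z - (a == rshift n i)%:Z.
(** The levels decrease to 1 and stay positive, so that the positive roots are eps_i - eps_j for i <
    j, eps_i + eps_j and 2 eps_i. *)
Definition sp_level (i : 'I_n) : int := n%:Z - i%:Z.

Lemma sp_conjl i : sp_conj (lshift n i) = rshift n i.
Proof. by rewrite /sp_conj (unsplitK (inl _)). Qed.

Lemma sp_conjr i : sp_conj (rshift n i) = lshift n i.
Proof. by rewrite /sp_conj (unsplitK (inr _)). Qed.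

Lemma sp_signl i : sp_sign (lshift n i) = 1.
Proof. by rewrite /sp_sign (unsplitK (inl _)). Qed.

Lemma sp_signr i : sp_sign (rshift n i) = -1.
Proof. by rewrite /sp_sign (unsplitK (inr _)). Qed.

Lemma sp_conjK : involutive sp_conj.
Proof. by move=> a; case: (split_ordP a) => i ->; rewrite ?(sp_conjl, sp_conjr). Qed.

Lemma sp_sign_conj a : sp_sign (sp_conj a) = - sp_sign a.
Proof.
by case: (split_ordP a) => i ->; rewrite ?(sp_conjl, sp_conjr, sp_signl, sp_signr, opprK).
Qed.

Lemma sp_sign_sqr a : sp_sign a * sp_sign a = 1.
Proof.
by case: (split_ordP a) => i ->; rewrite ?(sp_signl, sp_signr, mulN1r, opprK, mulr1).
Qed.

Lemma sp_eps_conj i a : sp_eps i (sp_conj a) = - sp_eps i a.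
Proof.
case: (split_ordP a) => j ->; rewrite /sp_eps ?(sp_conjl, sp_conjr);
  by rewrite ?(eq_lshift, eq_rshift, eq_lrshift, eq_rlshift); case: (j == i).
Qed.

Lemma symJE a b : symJ K n a b = sp_sign a * (b == sp_conj a)%:R.
Proof.
rewrite /symJ; case: (split_ordP a) => i ->; case: (split_ordP b) => j ->;
  rewrite ?(block_mxEul, block_mxEur, block_mxEdl, block_mxEdr) !mxE;
  rewrite ?(sp_conjl, sp_conjr, sp_signl, sp_signr);
  by rewrite ?(eq_lshift, eq_rshift, eq_lrshift, eq_rlshift) ?(mulr0, mul1r, mulN1r) // eq_sym.
Qed.

Lemma mem_spE (A : 'M[K]_(n + n)) : A \in sp_space K n <->
  forall a b, A a b = - (sp_sign a * sp_sign b) * A (sp_conj b) (sp_conj a).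
Proof.
have E a b : (A^T *m symJ K n + symJ K n *m A) a b =
    sp_sign a * A (sp_conj a) b - sp_sign b * A (sp_conj b) a.
  rewrite 3!mxE (bigD1 (sp_conj b)) //= [X in _ + X](bigD1 (sp_conj a)) //=.
  rewrite !big1 ?addr0.
  - by rewrite !symJE !mxE sp_conjK !eqxx !mulr1 sp_sign_conj; ring.
  - by move=> k /negPf ka; rewrite symJE ka mulr0 mul0r.
  - move=> k kb; rewrite symJE; case: eqP => [bk|_]; last by rewrite !mulr0.
    by rewrite bk sp_conjK eqxx in kb.
rewrite mem_sp; split=> [/eqP/matrixP h a b|h].
  have := h (sp_conj a) b; rewrite E mxE sp_conjK sp_sign_conj mulNr.
  move=> /eqP; rewrite -opprD oppr_eq0 addr_eq0 => /eqP h'.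
  by rewrite -[LHS]mul1r -(sp_sign_sqr a) -mulrA h'; ring.
apply/eqP/matrixP => a b; rewrite E mxE [A (sp_conj a) b]h sp_sign_conj sp_conjK.
by have := sp_sign_sqr a => s2; ring: s2.
Qed.

(** E_ab plus its image under the linear involution of gl_2n whose fixed space is sp_2n; hence the
    factor 1/2 in [sp_X_span]. *)
Definition sp_X a b : 'M[K]_(n + n) :=
  delta_mx a b - (sp_sign a * sp_sign b) *: delta_mx (sp_conj b) (sp_conj a).

Lemma sp_cartan_mx i : cartan_mx K sp_eps i =
  delta_mx (lshift n i) (lshift n i) - delta_mx (rshift n i) (rshift n i).
Proof.
apply/matrixP => a b; rewrite !mxE /sp_eps; have [<-|ab] := eqVneq a b.
  by rewrite !andbb mulr1n intrB.
rewrite mulr0n.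
case: (a =P lshift n i) => [ai|_]; case: (a =P rshift n i) => [ai'|_];
  case: (b =P lshift n i) => [bi|_]; case: (b =P rshift n i) => [bi'|_];
  rewrite ?subrr //.
all: try by rewrite ?ai ?bi ?eqxx in ab.
all: try by rewrite ?ai' ?bi' ?eqxx in ab.
all: by move: ai'; rewrite ai => /eqP; rewrite eq_lrshift.
Qed.

Fact sp_X_mem a b : sp_X a b \in mxlie_space (sp K n).
Proof.
apply/mem_spE => c d; rewrite /sp_X !mxE.
rewrite !(can2_eq sp_conjK sp_conjK) !sp_conjK [(d == b) && _]andbC.
rewrite [(d == sp_conj a) && _]andbC.
have s2 : (sp_sign a * sp_sign b) * (sp_sign a * sp_sign b) = 1.
  by rewrite mulrACA !sp_sign_sqr mulr1.
case: (boolP ((c == a) && (d == b))) => [/andP[/eqP -> /eqP ->]|_] /=.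
  by ring: s2.
case: (boolP ((c == sp_conj b) && _)) => [/andP[/eqP -> /eqP ->]|_] /=.
  by rewrite !sp_sign_conj; ring.
by rewrite !(mulr0, subr0).
Qed.

Fact sp_X_weight i a b c d : sp_X a b c d != 0 ->
  sp_eps i c - sp_eps i d = sp_eps i a - sp_eps i b.
Proof.
rewrite /sp_X !mxE.
case: (boolP ((c == a) && (d == b))) => [/andP[/eqP -> /eqP ->]//|_] /=.
case: (boolP ((c == sp_conj b) && _)) => [/andP[/eqP -> /eqP ->]|_] /=.
  by move=> _; rewrite !sp_eps_conj opprK addrC.
by rewrite mulr0 subr0 eqxx.
Qed.

Fact sp_X_span A : A \in mxlie_space (sp K n) ->
  A = 2^-1 *: \sum_a \sum_b A a b *: sp_X a b.
Proof.
move=> /mem_spE h.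
suff -> : \sum_a \sum_b A a b *: sp_X a b = A + A.
  by rewrite -mulr2n -scaler_nat scalerA mulVf ?scale1r ?pnatr_eq0.
rewrite /sp_X; under eq_bigr do under eq_bigr do rewrite scalerBr.
under eq_bigr do rewrite sumrB.
rewrite sumrB -matrix_sum_delta -[X in _ = _ + X]opprK; congr (_ - _).
rewrite (reindex_inj (inv_inj sp_conjK)) /=.
under eq_bigr do rewrite (reindex_inj (inv_inj sp_conjK)) /=.
rewrite exchange_big /= [in RHS](matrix_sum_delta A) -sumrN.
apply: eq_bigr => a _; rewrite -sumrN; apply: eq_bigr => b _.
rewrite !sp_conjK -scaleNr scalerA; congr (_ *: _).
by rewrite [A a b]h !sp_sign_conj; ring.
Qed.

Lemma sp_XE i : sp_X (lshift n i) (lshift n i) = cartan_mx K sp_eps i.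
Proof. by rewrite sp_cartan_mx /sp_X sp_conjl sp_signl mulr1 scale1r. Qed.

Lemma sp_X_diag a : exists k : 'I_n -> K,
  sp_X a a = \sum_i k i *: cartan_mx K sp_eps i.
Proof.
exists (fun i => (sp_eps i a)%:~R); case: (split_ordP a) => j ->.
  rewrite (bigD1 j) //= big1 ?addr0 => [|i /negPf ij].
    by rewrite sp_XE /sp_eps eqxx eq_lrshift subr0 scale1r.
  by rewrite /sp_eps eq_lshift eq_lrshift eq_sym ij subrr scale0r.
rewrite (bigD1 j) //= big1 ?addr0 => [|i /negPf ij].
  rewrite sp_cartan_mx /sp_X sp_conjr sp_sign_sqr /sp_eps eqxx eq_rlshift.
  by rewrite sub0r scaleN1r scale1r opprB.
by rewrite /sp_eps eq_rshift eq_rlshift eq_sym ij subrr scale0r.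
Qed.

Fact sp_cartan_mem i : cartan_mx K sp_eps i \in mxlie_space (sp K n).
Proof. by rewrite -sp_XE sp_X_mem. Qed.

Definition sp_depth a : int :=
  match split a with inl i => sp_level i | inr i => - sp_level i end.

Lemma sp_depthl i : sp_depth (lshift n i) = sp_level i.
Proof. by rewrite /sp_depth (unsplitK (inl _)). Qed.

Lemma sp_depthr i : sp_depth (rshift n i) = - sp_level i.
Proof. by rewrite /sp_depth (unsplitK (inr _)). Qed.

Lemma sp_height a b :
  \sum_i sp_level i * (sp_eps i a - sp_eps i b) = sp_depth a - sp_depth b.
Proof.
have E c : \sum_i sp_level i * sp_eps i c = sp_depth c.
  case: (split_ordP c) => j ->; rewrite ?(sp_depthl, sp_depthr) (bigD1 j) //= big1.
  - by rewrite addr0 /sp_eps eqxx eq_lrshift subr0 mulr1.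
  - move=> i /negPf ij.
    by rewrite /sp_eps eq_lshift eq_lrshift eq_sym ij subrr mulr0.
  - by rewrite addr0 /sp_eps eqxx eq_rlshift sub0r mulrN1.
  - move=> i /negPf ij.
    by rewrite /sp_eps eq_rshift eq_rlshift eq_sym ij subrr mulr0.
by under eq_bigr do rewrite mulrBr; rewrite sumrB !E.
Qed.

Fact sp_X_ht a b : a != b ->
  \sum_i sp_level i * (sp_eps i a - sp_eps i b) != 0.
Proof.
rewrite sp_height; case: (split_ordP a) => i ->; case: (split_ordP b) => j ->;
  rewrite ?(sp_depthl, sp_depthr) ?(eq_lshift, eq_rshift) /sp_level -?val_eqE /=;
  by have := ltn_ord i; have := ltn_ord j; lia.
Qed.

Definition sp_root_data : root_data (mxlie_alg (sp K n)) :=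
  mx_root_data sp_cartan_mem sp_X_mem sp_X_weight sp_X_span sp_X_diag sp_X_ht.

End TypeC.

(** * Highest weights of modules satisfying (1) *)

(** From e^2 = 0 and [h, e] = 2 e one gets 2 efe = 2 e, so efe = e; likewise fef = f. Then h^2 = ef
    + fe, and multiplying by h = ef - fe gives h^3 = h. *)
Lemma sl2_tripotent (K : numFieldType) (L : lieAlgType K) (V : lmodType K)
    (rho : rep L V) (e f h : L) :
  lie e f = h -> lie h e = 2%:R *: e -> lie h f = - 2%:R *: f ->
  (forall v, rho e (rho e v) = 0) -> (forall v, rho f (rho f v) = 0) ->
  forall v, rho h (rho h (rho h v)) = rho h v.
Proof.
move=> ef he hf e2 f2.
have hE v : rho h v = rho e (rho f v) - rho f (rho e v) by rewrite -ef rep_lie.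
have halve (u v : V) : u + u = 2%:R *: v -> u = v.
  rewrite -mulr2n -scaler_nat => /eqP; rewrite -subr_eq0 -scalerBr scaler_eq0.
  by rewrite pnatr_eq0 subr_eq0 => /eqP.
have efe v : rho e (rho f (rho e v)) = rho e v.
  apply: halve; rewrite -rep_scalel -he rep_lie !hE rep_subr e2 rep0r subr0.
  by rewrite e2 sub0r opprK.
have fef v : rho f (rho e (rho f v)) = rho f v.
  apply: halve; apply: oppr_inj; rewrite -scaleNr -rep_scalel -hf rep_lie !hE.
  by rewrite rep_subr f2 rep0r f2 sub0r subr0 opprD.
have hh v : rho h (rho h v) = rho e (rho f v) + rho f (rho e v).
  by rewrite !hE !rep_subr efe fef f2 e2 !rep0r !(subr0, sub0r) opprK.
move=> v; rewrite hh hE !(rep_addr, rep_subr, rep_oppr).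
by rewrite efe fef f2 e2 !rep0r subr0 add0r.
Qed.

(** Take [p] least such that [mu] vanishes from [p] on. *)
Lemma step_fun N (mu : 'I_N -> int) : (forall i, 0 <= mu i <= 1) ->
  (forall i j : 'I_N, (i < j)%N -> mu j <= mu i) ->
  exists p, (p <= N)%N /\ forall i : 'I_N, mu i = (i < p)%N%:Z.
Proof.
move=> mu01 mu_dec; pose P p := [forall i : 'I_N, (p <= i)%N ==> (mu i == 0)].
have PN : P N by apply/forallP => i; rewrite leqNgt ltn_ord.
have [p /forallP Pp pmin] := ex_minnP (ex_intro P _ PN).
exists p; split=> [|i]; first exact: pmin.
case: ltnP => [ip|pi]; last by apply/eqP; exact: (implyP (Pp i)).
have : ~~ P p.-1.
  by apply/negP => /pmin; case: p ip {Pp pmin} => //= p _; rewrite ltnn.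
case/forallPn => j; rewrite negb_imply => /andP[pj muj].
have jp : (j < p)%N by rewrite ltnNge; apply: contra muj => pj'; exact: (implyP (Pp j)).
have := mu01 j; have := mu01 i.
have : (i <= j)%N by lia.
rewrite leq_eqVlt => /predU1P[/val_inj ij|/mu_dec]; first by move: muj; rewrite -ij; lia.
by move: muj; lia.
Qed.

Lemma delta_mx_col (K : fieldType) N (a b : 'I_N) :
  delta_mx a b = delta_mx a 0 *m (delta_mx b 0 : 'cV[K]_N)^T.
Proof. by rewrite trmx_delta mul_delta_mx. Qed.

Section GLShape.
Variables (K : numFieldType) (N : nat) (V : lmodType K).
Variable rho : rep (mxlie_alg (gl K N)) V.
Local Notation elt := (mxelt (gl K N)).
Local Notation D := (gl_root_data K N).

Hypothesis rho_rank1 : forall (r u : 'cV[K]_N) v,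
  rho (elt (r *m u^T)) (rho (elt (r *m u^T)) v) =
  \tr (r *m u^T) *: rho (elt (r *m u^T)) v.

Lemma gl_cartanE i : @cartan _ _ D i = elt (delta_mx i i).
Proof. by rewrite -gl_cartan_mx. Qed.

Lemma gl_cartan_idem (i : 'I_N) v :
  rho (elt (delta_mx i i)) (rho (elt (delta_mx i i)) v) = rho (elt (delta_mx i i)) v.
Proof.
by rewrite delta_mx_col rho_rank1 -delta_mx_col mxtrace_delta eqxx scale1r.
Qed.

Lemma gl_tripotent : tripotent D rho.
Proof. by move=> i v; rewrite gl_cartanE !gl_cartan_idem. Qed.

Lemma gl_hw_shape mu v : v != 0 -> is_hw (D := D) rho mu v ->
  exists p, (p <= N)%N /\ forall i : 'I_N, mu i = (i < p)%N%:Z.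
Proof.
move=> vn0 [Hv Xv]; have mu01 i : 0 <= mu i <= 1.
  have := gl_cartan_idem i v; rewrite -!gl_cartanE !(Hv, rep_scaler) => /eqP.
  rewrite -subr_eq0 scalerA -scalerBl scaler_eq0 (negPf vn0) orbF.
  rewrite -intrM -intrB intr_eq0 -{3}[mu i]mulr1 -mulrBr mulf_eq0; lia.
apply: step_fun => [//|i j ij].
(* Here mu i = 0 and mu j = 1, so E_ji v would be non-zero with entry 2 at j. *)
rewrite leNgt; apply/negP => lt_mu.
have ev : rho (elt (delta_mx i j)) v = 0.
  apply: (Xv (i, j)); rewrite /height /=; under eq_bigr do rewrite mulrBr.
  by rewrite sumrB !sum_level_eps /glsl_level; lia.
have Hf k := @cartan_root _ _ D k (j, i).
have ef : lie (elt (delta_mx i j)) (elt (delta_mx j i)) = @cartan _ _ D i - @cartan _ _ D j.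
  rewrite mxelt_lie ?memvf // !mul_delta_mx !gl_cartanE; exact: linearB.
have := reflect_weight gl_tripotent Hf Hv ev.
rewrite ef rep_addl -scaleN1r rep_scalel !Hv scaleN1r -scalerBl -intrB.
rewrite scaler_eq0 negb_or vn0 andbT intr_eq0 subr_eq0 lt_eqF // => /(_ isT j).
rewrite /= /gl_eps eqxx -val_eqE /= ltn_eqF //.
by have := mu01 i; have := mu01 j; lia.
Qed.

End GLShape.

Section SLShape.
Variables (K : numFieldType) (N : nat) (V : lmodType K).
Variable rho : rep (mxlie_alg (sl K N.+1)) V.
Local Notation elt := (mxelt (sl K N.+1)).
Local Notation D := (sl_root_data K N).

Hypothesis rho_rank1 : forall (r u : 'cV[K]_N.+1) v, Defs.form u r = 0 ->
  rho (elt (r *m u^T)) (rho (elt (r *m u^T)) v) = 0.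

Lemma sl_cartanE i : @cartan _ _ D i = elt (delta_mx i i - delta_mx 0 0).
Proof. by rewrite -sl_cartan_mx. Qed.

Lemma sl_rootE (a b : 'I_N.+1) : a != b -> @root_vec _ _ D (a, b) = elt (delta_mx a b).
Proof. by rewrite /= => /negPf ->. Qed.

Lemma sl_rho_sqr (a b : 'I_N.+1) v : a != b ->
  rho (elt (delta_mx a b)) (rho (elt (delta_mx a b)) v) = 0.
Proof.
move=> ab; rewrite delta_mx_col rho_rank1 // /Defs.form trmx_delta mul_delta_mx_cond.
by rewrite eq_sym (negPf ab) mulr0n mxE.
Qed.

Lemma sl_cartan_lie (a b : 'I_N.+1) : a != b ->
  lie (elt (delta_mx a b)) (elt (delta_mx b a)) = @cartan _ _ D a - @cartan _ _ D b.
Proof.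
move=> ab; have ba : b != a by rewrite eq_sym.
rewrite mxelt_lie ?sl_mem_delta // !mul_delta_mx !sl_cartanE.
by rewrite -[RHS]linearB opprB addrA subrK.
Qed.

Lemma sl_tripotent : tripotent D rho.
Proof.
move=> i; have [i0|i0] := eqVneq i 0.
  by rewrite sl_cartanE i0 subrr /mxelt linear0 => v; rewrite !rep0l.
have i0' : 0 != i by rewrite eq_sym.
have c0 : @cartan _ _ D 0 = 0 by rewrite sl_cartanE subrr /mxelt linear0.
apply: (@sl2_tripotent _ _ _ rho (elt (delta_mx i 0)) (elt (delta_mx 0 i))).
- by rewrite sl_cartan_lie // c0 subr0.
- rewrite -sl_rootE // cartan_root /= /sl_eps !eqxx [0 == i]eq_sym (negPf i0); congr (_ *: _).
- rewrite -sl_rootE // cartan_root /= /sl_eps !eqxx [0 == i]eq_sym (negPf i0); congr (_ *: _).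
- by move=> v; exact: sl_rho_sqr.
- by move=> v; exact: sl_rho_sqr.
Qed.

Lemma sl_hw_shape mu v : v != 0 -> is_hw (D := D) rho mu v ->
  exists p, (0 < p <= N.+1)%N /\ forall i : 'I_N.+1, mu i = (i < p)%N%:Z - 1.
Proof.
move=> vn0 [Hv Xv].
have mu0 : mu 0 = 0.
  have := Hv 0; rewrite sl_cartanE subrr /mxelt linear0 rep0l => /esym/eqP.
  by rewrite scaler_eq0 (negPf vn0) orbF intr_eq0 => /eqP.
have mu1 i := tripotent_eig sl_tripotent vn0 (Hv i).
have mu_dec (i j : 'I_N.+1) : (i < j)%N -> mu j <= mu i.
  move=> ij; have ijn : i != j by rewrite -val_eqE /= ltn_eqF.
  rewrite leNgt; apply/negP => lt_mu.
  have ev : rho (elt (delta_mx i j)) v = 0.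
    rewrite -sl_rootE //; apply: Xv; rewrite /height /=.
    have [t ->] := sl_height i j.
    move: ij; rewrite -!val_eqE /=; case: (nat_of_ord i) => [|i'];
      case: (nat_of_ord j) => [|j'] /=; lia.
  have Hf k := @cartan_root _ _ D k (j, i).
  rewrite sl_rootE 1?eq_sym // in Hf.
  have := reflect_weight sl_tripotent Hf Hv ev.
  rewrite sl_cartan_lie // rep_addl -scaleN1r rep_scalel !Hv scaleN1r -scalerBl -intrB.
  rewrite scaler_eq0 negb_or vn0 andbT intr_eq0 subr_eq0 lt_eqF // => /(_ isT) h.
  have := h j; have := h i; rewrite /= /sl_eps !eqxx [j == i]eq_sym (negPf ijn).
  have -> : (j == 0) = false by rewrite -val_eqE /= gtn_eqF //; lia.
  (* For i = 0 the root has the value 2 at j, since E_jj - E_00 sees both indices. *)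
  case: (i =P 0) => [i0|_] /=; last by lia.
  by move: lt_mu; rewrite i0 mu0; lia.
have mu_le i : mu i <= 0.
  case: (posnP i) => [i0|/(mu_dec 0)]; last by rewrite mu0.
  by rewrite (_ : i = 0) ?mu0 //; exact: val_inj.
(* The entries are 0 or -1, and adding 1 makes them a step; its value 1 at index 0 gives p > 0. *)
have [||p [pN pE]] := @step_fun N.+1 (fun i => mu i + 1).
- by move=> i; have := mu_le i; have := mu1 i; lia.
- by move=> i j /mu_dec; lia.
exists p; split=> [|i]; last by rewrite -pE addrK.
by rewrite pN andbT; have := pE 0; rewrite mu0 /=; case: (p).
Qed.

End SLShape.

Section SPShape.
Variables (K : numFieldType) (n : nat) (V : lmodType K).
Variable rho : rep (mxlie_alg (sp K n)) V.
Local Notation elt := (mxelt (sp K n)).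
Local Notation D := (sp_root_data K n).

Hypothesis rho_rank1 : forall (u : 'cV[K]_(n + n)) v,
  rho (elt (u *m (symbar u)^T)) (rho (elt (u *m (symbar u)^T)) v) = 0.

Lemma sp_cartanE i : @cartan _ _ D i =
  elt (delta_mx (lshift n i) (lshift n i) - delta_mx (rshift n i) (rshift n i)).
Proof. by rewrite -sp_cartan_mx. Qed.

Lemma symbar_delta (b : 'I_(n + n)) :
  symbar (delta_mx b 0) = - sp_sign K b *: (delta_mx (sp_conj b) 0 : 'cV[K]_(n + n)).
Proof.
apply/colP => a; rewrite symbarE mxE (bigD1 b) //= big1 => [|k kb].
  rewrite symJE !mxE !eqxx mulr1 addr0 andbT.
  have -> : (b == sp_conj a) = (a == sp_conj b).
    by apply/eqP/eqP => ->; rewrite sp_conjK.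
  case: eqP => [->|_]; last by rewrite !mulr0.
  by rewrite sp_sign_conj.
by rewrite [delta_mx _ _ _ _]mxE (negPf kb) mulr0.
Qed.

(** Up to sign this matrix unit is the rank-one element of a standard basis vector. These long root
    vectors suffice for tripotency, since their brackets give all the Cartan elements. *)
Lemma sp_delta_sqr (b : 'I_(n + n)) v :
  rho (elt (delta_mx b (sp_conj b))) (rho (elt (delta_mx b (sp_conj b))) v) = 0.
Proof.
have -> : delta_mx b (sp_conj b) =
    (- sp_sign K b) *: (delta_mx b 0 *m (symbar (delta_mx b 0))^T).
  rewrite symbar_delta linearZ /= -scalemxAr -delta_mx_col scalerA mulrNN.
  by rewrite sp_sign_sqr scale1r.
rewrite /mxelt linearZ !rep_scalel rep_scaler.
by rewrite -/(elt _) rho_rank1 !scaler0.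
Qed.

Lemma sp_X_conj (b : 'I_(n + n)) : sp_X K b (sp_conj b) = 2%:R *: delta_mx b (sp_conj b).
Proof.
by rewrite /sp_X sp_conjK sp_sign_conj mulrN sp_sign_sqr scaleN1r opprK -mulr2n scaler_nat.
Qed.

Lemma sp_delta_mem (b : 'I_(n + n)) : delta_mx b (sp_conj b) \in sp_space K n.
Proof.
have := sp_X_mem K b (sp_conj b); rewrite sp_X_conj => /(memvZ 2^-1).
by rewrite scalerA mulVf ?scale1r ?pnatr_eq0.
Qed.

Lemma sp_long_lie (i : 'I_n) :
  lie (elt (delta_mx (lshift n i) (rshift n i)))
      (elt (delta_mx (rshift n i) (lshift n i))) = @cartan _ _ D i.
Proof.
rewrite mxelt_lie ?mul_delta_mx ?sp_cartanE //.
  by rewrite -sp_conjl sp_delta_mem.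
by rewrite -sp_conjr sp_delta_mem.
Qed.

Lemma sp_long_root (k : 'I_n) (b : 'I_(n + n)) :
  lie (@cartan _ _ D k) (elt (delta_mx b (sp_conj b))) =
  (2%:R * sp_eps k b)%:~R *: elt (delta_mx b (sp_conj b)).
Proof.
have -> : elt (delta_mx b (sp_conj b)) = 2^-1 *: @root_vec _ _ D (b, sp_conj b).
  rewrite /= -/(elt _) sp_X_conj /mxelt linearZ scalerA mulVf ?scale1r //.
  by rewrite pnatr_eq0.
have lZ a (x y : mxlie_alg (sp K n)) : lie x (a *: y) = a *: lie x y.
  have l0 : lie x 0 = 0.
    by have := lie_linearr (-1) x 0 0; rewrite scaler0 scaleN1r addNr add0r.
  by have := lie_linearr a x y 0; rewrite l0 !addr0.
rewrite lZ cartan_root !scalerA mulrC; congr (_%:~R * _ *: _).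
by rewrite /= sp_eps_conj opprK mulr_natl.
Qed.

Lemma sp_tripotent : tripotent D rho.
Proof.
move=> i; apply: (sl2_tripotent (sp_long_lie i)).
- by rewrite -sp_conjl sp_long_root /sp_eps eqxx eq_lrshift.
- rewrite -sp_conjr sp_long_root /sp_eps eqxx eq_rlshift sub0r mulrN1.
  by rewrite rmorphN.
- by rewrite -sp_conjl; exact: sp_delta_sqr.
- by rewrite -sp_conjr; exact: sp_delta_sqr.
Qed.

Lemma sp_short_lie (i j : 'I_n) : i != j ->
  lie (elt (sp_X K (lshift n i) (lshift n j))) (elt (sp_X K (lshift n j) (lshift n i)))
  = @cartan _ _ D i - @cartan _ _ D j.
Proof.
move=> ij; have ji : j != i by rewrite eq_sym.
rewrite mxelt_lie ?sp_X_mem // !sp_cartanE -[RHS]linearB; congr (elt _).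
rewrite /sp_X !sp_conjl !sp_signl mulr1 !scale1r !(mulmxBl, mulmxBr).
rewrite !mul_delta_mx !(mul_delta_mx_0, eq_rlshift, eq_lrshift) //.
rewrite !subr0 !sub0r !opprK; apply/matrixP => a b; rewrite !mxE; ring.
Qed.

Lemma sp_hw_shape mu v : v != 0 -> is_hw (D := D) rho mu v ->
  exists p, (p <= n)%N /\ forall i : 'I_n, mu i = (i < p)%N%:Z.
Proof.
move=> vn0 [Hv Xv].
have mu1 i := tripotent_eig sp_tripotent vn0 (Hv i).
apply: step_fun => [i|i j ij].
  have ev : rho (elt (delta_mx (lshift n i) (sp_conj (lshift n i)))) v = 0.
    have : rho (@root_vec _ _ D (lshift n i, sp_conj (lshift n i))) v = 0.
      apply: Xv; rewrite /height /= sp_height sp_conjl sp_depthl sp_depthr /sp_level.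
      by have := ltn_ord i; lia.
    rewrite /= sp_X_conj /mxelt linearZ rep_scalel => /eqP.
    by rewrite scaler_eq0 pnatr_eq0 => /eqP.
  (* Lowering by the long root 2 eps_i: if mu i is non-zero, then mu i - 2 is at least -1, so mu i =
     1. *)
  have Hf k := sp_long_root k (rshift n i).
  have := reflect_weight sp_tripotent Hf Hv ev.
  rewrite sp_conjl sp_conjr sp_long_lie Hv scaler_eq0 negb_or vn0 andbT intr_eq0.
  case: eqP => [-> //|mun0 /(_ isT i)].
  rewrite /sp_eps eqxx eq_rlshift /=.
  by have := mu1 i; lia.
have ijn : i != j by rewrite -val_eqE /= ltn_eqF.
(* Lowering by eps_i - eps_j would require mu i >= 0 >= mu j. *)
rewrite leNgt; apply/negP => lt_mu.
have ev : rho (@root_vec _ _ D (lshift n i, lshift n j)) v = 0.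
  apply: Xv; rewrite /height /= sp_height !sp_depthl /sp_level.
  by have := ltn_ord j; lia.
have Hf k := @cartan_root _ _ D k (lshift n j, lshift n i).
have := reflect_weight sp_tripotent Hf Hv ev.
rewrite /= sp_short_lie // rep_addl -scaleN1r rep_scalel !Hv scaleN1r -scalerBl -intrB.
rewrite scaler_eq0 negb_or vn0 andbT intr_eq0 subr_eq0 lt_eqF // => /(_ isT) h.
have := h j; have := h i; rewrite /= /sp_eps !eq_lrshift !eq_lshift !eqxx.
rewrite [j == i]eq_sym (negPf ijn) /=.
by have := mu1 i; have := mu1 j; lia.
Qed.

End SPShape.

(** * The models *)

Lemma card_ord_lt N p : (p <= N)%N -> #|[set i : 'I_N | (i < p)%N]| == p.
Proof.
move=> pN; apply/eqP; rewrite -[RHS]card_ord -cardsT.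
have w_inj : injective (widen_ord pN).
  by move=> i j /(congr1 val) ij; exact: val_inj.
rewrite -(card_imset _ w_inj); congr #|pred_of_set _|.
apply/setP => i; rewrite inE; apply/idP/imsetP => [ip|[j _ ->] //=].
by exists (Ordinal ip) => //; exact: val_inj.
Qed.

Definition top_set N p (pN : (p <= N)%N) : psubset N p :=
  exist _ [set i : 'I_N | (i < p)%N] (card_ord_lt pN).

Lemma in_top_set N p (pN : (p <= N)%N) i : (i \in val (top_set pN)) = (i < p)%N.
Proof. by rewrite inE. Qed.

(** The cardinal of [T] forces p' = p: of the weights allowed by the shape lemmas only one occurs in
    a given exterior power. *)
Lemma top_set_unique N p p' (pN : (p <= N)%N) (T : psubset N p) :
  (p' <= N)%N -> (forall i, (i \in val T) = (i < p')%N) ->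
  p' = p /\ T = top_set pN.
Proof.
move=> p'N TE; have ET : val T = [set i : 'I_N | (i < p')%N].
  by apply/setP => i; rewrite TE inE.
have pp : p' = p by rewrite -(eqP (card_ord_lt p'N)) -ET; exact/eqP/(valP T).
by split=> //; apply: val_inj; rewrite ET pp.
Qed.

Section ExtModel.
Variables (K : numFieldType) (N p : nat).

(** Diagonal matrices scale each coordinate separately, so any non-zero coordinate of a weight
    vector reveals the weight. *)
Lemma weight_support m (eps : 'I_m -> 'I_N -> int) i (mu : int)
    (w : extpow K N p) T :
  ext_act (cartan_mx K eps i) w = mu%:~R *: w -> w T != 0 ->
  mu = \sum_(a in val T) eps i a.
Proof.
move=> /(congr1 (fun w : extpow K N p => w T)); rewrite ext_act_diag ffunE => E wT.
move: E; rewrite -[RHS]/(_ * _) => /(mulIf wT) E.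
apply: (@intr_inj K); rewrite -E rmorph_sum; apply: eq_bigr => a _.
by rewrite mxE.
Qed.

Lemma ext_basis_weight m (eps : 'I_m -> 'I_N -> int) i (S : psubset N p) :
  ext_act (cartan_mx K eps i) (ext_basis K S) =
  (\sum_(a in val S) eps i a)%:~R *: ext_basis K S.
Proof.
apply/ffunP => T; rewrite ext_act_diag !ffunE.
case: (T =P S) => [->|_]; last by rewrite mulr0 scaler0.
rewrite rmorph_sum -[RHS]/(_ * _); congr (_ * _).
by apply: eq_bigr => a _; rewrite mxE.
Qed.

Lemma submodule_basis (L : lieAlgType K) (rho : rep L (extpow K N p)) U w S :
  submodule rho U -> U w -> w != 0 -> (forall T, w T != 0 -> T = S) ->
  U (ext_basis K S).
Proof.
move=> [U0 Ul _] Uw wn0 /ext_basis_span wE.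
have wS : w S != 0 by apply: contraNneq wn0 => wS; rewrite wE wS scale0r.
have := Ul (w S)^-1 w 0 Uw U0; rewrite addr0 {2}wE scalerA mulVf ?scale1r //.
Qed.

Variable g : mxLie K N.

Lemma ext_rep_rank1 (r u : 'cV[K]_N) w : r *m u^T \in mxlie_space g ->
  ext_rep g p (mxelt g (r *m u^T)) (ext_rep g p (mxelt g (r *m u^T)) w) =
  \tr (r *m u^T) *: ext_rep g p (mxelt g (r *m u^T)) w.
Proof. by move=> rug; rewrite /= /mxlie_ext_act mxeltK // ext_act_rank1. Qed.

Lemma ext_rep_irreducible S :
  (forall A, A \in mxlie_space g -> A^T \in mxlie_space g) ->
  (forall U, submodule (ext_rep g p) U -> (exists2 x, U x & x != 0) ->
    U (ext_basis K S)) ->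
  irreducible_rep (ext_rep g p).
Proof.
move=> g_tr; apply: (@form_irreducible K (mxlie_alg g) (extpow K N p) (ext_rep g p)
  (@ext_form K N p) (fun x => mxelt g (val x)^T) (ext_basis K S)).
- exact: ext_form_linear.
- exact: ext_formC.
- move=> x w y; rewrite /= /mxlie_ext_act mxeltK ?ext_form_tr //.
  exact/g_tr/(valP x).
- exact: ext_form_basis.
Qed.

End ExtModel.

Lemma sum_delta_in (I : finType) (T : {set I}) i :
  \sum_(a in T) (a == i)%:Z = (i \in T)%:Z.
Proof.
case: (boolP (i \in T)) => iT.
  by rewrite (bigD1 i) //= eqxx big1 ?addr0 // => a /andP[_ /negPf ->].
by rewrite big1 // => a aT; case: eqP => // E; rewrite -E aT in iT.
Qed.

Section GLModel.
Variables (K : numFieldType) (N p : nat) (pN : (p <= N)%N).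
Local Notation D := (gl_root_data K N).

Lemma gl_ext_hw : is_hw (D := D) (ext_rep (gl K N) p)
  (fun i : 'I_N => (i < p)%N%:Z) (ext_basis K (top_set pN)).
Proof.
split=> [i|[a b]] /=.
  rewrite /mxlie_ext_act mxeltK ?gl_cartan_mem // ext_basis_weight.
  by rewrite /gl_eps sum_delta_in in_top_set.
rewrite /height /=; under eq_bigr do rewrite mulrBr.
rewrite sumrB !sum_level_eps /glsl_level => ab.
rewrite /mxlie_ext_act mxeltK ?memvf // ext_act_delta_basis //.
  by rewrite -val_eqE /=; lia.
by rewrite !in_top_set; lia.
Qed.

Lemma gl_ext_irreducible : irreducible_rep (ext_rep (gl K N) p).
Proof.
apply: (ext_rep_irreducible (S := top_set pN)) => [A _|U Um Un0]; first exact: memvf.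
have rank1 (r u : 'cV[K]_N) w := ext_rep_rank1 (p := p) w
  (memvf (r *m u^T) : _ \in mxlie_space (gl K N)).
have [mu [w [Uw wn0 w_hw]]] := hw_exists (gl_tripotent rank1) Um Un0.
have [p' [p'N muE]] := gl_hw_shape rank1 wn0 w_hw.
apply: submodule_basis Um Uw wn0 _ => T wT.
suff TE i : (i \in val T) = (i < p')%N by case: (top_set_unique pN p'N TE).
have := w_hw.1 i; rewrite /= /mxlie_ext_act mxeltK ?gl_cartan_mem //.
move/weight_support/(_ wT); rewrite muE /gl_eps sum_delta_in.
by case: (_ \in _) (_ < _)%N => [] [].
Qed.

End GLModel.

Section SLModel.
Variables (K : numFieldType) (N p : nat) (pN : (p <= N.+1)%N) (p0 : (0 < p)%N).
Local Notation D := (sl_root_data K N).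

Lemma sl_ext_hw : is_hw (D := D) (ext_rep (sl K N.+1) p)
  (fun i : 'I_N.+1 => (i < p)%N%:Z - 1) (ext_basis K (top_set pN)).
Proof.
split=> [i|[a b]].
  rewrite /= /mxlie_ext_act mxeltK ?sl_cartan_mem // ext_basis_weight.
  by rewrite /sl_eps sumrB !sum_delta_in !in_top_set p0.
rewrite /height [X in 0 < X]/=; have [t ->] := sl_height a b => ab.
have {}ab : (a < b)%N.
  move: ab; rewrite -!val_eqE /=.
  by case: (nat_of_ord a) => [|a']; case: (nat_of_ord b) => [|b'] /=; lia.
have abn : a != b by rewrite -val_eqE /= ltn_eqF.
rewrite sl_rootE // /= /mxlie_ext_act mxeltK ?sl_mem_delta // ext_act_delta_basis //.
by rewrite !in_top_set; lia.
Qed.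

Lemma sl_ext_irreducible : irreducible_rep (ext_rep (sl K N.+1) p).
Proof.
apply: (ext_rep_irreducible (S := top_set pN)) => [A|U Um Un0].
  by rewrite !mem_sl mxtrace_tr.
have rank1 (r u : 'cV[K]_N.+1) w : Defs.form u r = 0 ->
    ext_rep (sl K N.+1) p (mxelt _ (r *m u^T))
      (ext_rep (sl K N.+1) p (mxelt _ (r *m u^T)) w) = 0.
  move=> ur; have tr0 : \tr (r *m u^T) = 0 by rewrite mxtrace_mulC trace_mx11.
  by rewrite ext_rep_rank1 ?tr0 ?scale0r // mem_sl tr0.
have [mu [w [Uw wn0 w_hw]]] := hw_exists (sl_tripotent rank1) Um Un0.
have [p' [/andP[p'0 p'N] muE]] := sl_hw_shape rank1 wn0 w_hw.
apply: submodule_basis Um Uw wn0 _ => T wT.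
have TE i : (i \in val T)%:Z - (0 \in val T)%:Z = (i < p')%N%:Z - 1.
  have := w_hw.1 i; rewrite [LHS]/= /mxlie_ext_act mxeltK ?sl_cartan_mem //.
  by move/weight_support/(_ wT); rewrite muE /sl_eps sumrB !sum_delta_in.
(* If 0 is not in [T], the normalized weight leaves no index in [T] at all, against p > 0. *)
case: (boolP (0 \in val T)) => T0; last first.
  have : #|val T| = 0%N.
    apply/eqP; rewrite cards_eq0; apply/eqP/setP => i; rewrite inE.
    by have := TE i; rewrite (negPf T0); case: (_ \in _) (_ < _)%N => [] [].
  by rewrite (eqP (valP T)) => p_0; exfalso; have := p0; rewrite p_0.
suff TE' i : (i \in val T) = (i < p')%N by case: (top_set_unique pN p'N TE').
by have := TE i; rewrite T0; case: (_ \in _) (_ < _)%N => [] [].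
Qed.

End SLModel.

Section SPModels.
Variables (K : numFieldType) (n : nat).
Local Notation D := (sp_root_data K n).

Lemma sp_tr (A : 'M[K]_(n + n)) : A \in sp_space K n -> A^T \in sp_space K n.
Proof.
move=> /mem_spE h; apply/mem_spE => a b; rewrite !mxE [LHS]h.
by rewrite [sp_sign K b * _]mulrC.
Qed.

Lemma sp_depth_le (a : 'I_(n + n)) : `|sp_depth a| <= n%:Z.
Proof.
case: (split_ordP a) => i ->; rewrite ?(sp_depthl, sp_depthr) /sp_level;
by have := ltn_ord i; lia.
Qed.

Lemma sp_depth_conj (a : 'I_(n + n)) : sp_depth (sp_conj a) = - sp_depth a.
Proof.
by case: (split_ordP a) => i ->; rewrite ?(sp_conjl, sp_conjr) ?(sp_depthl, sp_depthr) ?opprK.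
Qed.

Lemma sp_trace0 (u : 'cV[K]_(n + n)) : \tr (u *m (symbar u)^T) = 0.
Proof.
rewrite mxtrace_mulC trace_mx11 -/(Defs.form _ _) form_symbar big1 // => m _.
by rewrite mulrC subrr.
Qed.

Lemma sp_rank1_mem (u : 'cV[K]_(n + n)) : u *m (symbar u)^T \in mxlie_space (sp K n).
Proof.
by rewrite mem_sp symbarE trmx_mul trmxK trmx_mul symJ_tr !mulmxN !mulmxA subrr.
Qed.

Section Theta.
Variable q : nat.

Definition cons2 (x y : 'I_(n + n)) (g : 'I_q -> 'I_(n + n)) : 'I_q.+2 -> 'I_(n + n) :=
  fun j => if unlift ord0 j is Some j' then
    (if unlift ord0 j' is Some k then g k else y) else x.

Lemma cons2_0 x y g : cons2 x y g ord0 = x.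
Proof. by rewrite /cons2 unlift_none. Qed.

Lemma cons2_1 x y g : cons2 x y g (lift ord0 ord0) = y.
Proof. by rewrite /cons2 liftK unlift_none. Qed.

Lemma cons2_2 x y g k : cons2 x y g (lift ord0 (lift ord0 k)) = g k.
Proof. by rewrite /cons2 !liftK. Qed.

Lemma ord2P (j : 'I_q.+2) :
  [\/ j = ord0, j = lift ord0 ord0 | exists k, j = lift ord0 (lift ord0 k)].
Proof.
case: (unliftP ord0 j) => [j' ->|->]; last by constructor 1.
case: (unliftP ord0 j') => [k ->|->]; last by constructor 2.
by constructor 3; exists k.
Qed.

Lemma upd_cons2_0 x y g z : upd (cons2 x y g) ord0 z = cons2 z y g.
Proof.
apply: funext => j; case: (ord2P j) => [->|->|[k ->]].
- by rewrite updE cons2_0.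
- by rewrite updNE // !cons2_1.
- by rewrite updNE // !cons2_2.
Qed.

Lemma upd_cons2_1 x y g z : upd (cons2 x y g) (lift ord0 ord0) z = cons2 x z g.
Proof.
apply: funext => j; case: (ord2P j) => [->|->|[k ->]].
- by rewrite updNE // !cons2_0.
- by rewrite updE cons2_1.
- by rewrite updNE ?cons2_2 // (inj_eq lift_inj).
Qed.

(** [theta] contracts two slots of an alternating tensor with the symplectic form; by antisymmetry
    one coordinate for each m suffices. *)
Lemma theta_coord (w : extpow K (n + n) q.+2) (T : psubset (n + n) q) :
  theta w T =
  \sum_(m < n) ext_coord (cons2 (rshift n m) (lshift n m) (psub_elt T)) w.
Proof.
pose g w : K^o :=
  \sum_(m < n) ext_coord (cons2 (rshift n m) (lshift n m) (psub_elt T)) w.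
suff: (fun w => theta w T : K^o) =1 g by apply.
apply: extpow_ind_linear => [a x y|a x y|v]; rewrite /g.
- by rewrite theta_linear !ffunE.
- rewrite scaler_sumr -big_split /=; apply: eq_bigr => i _.
  exact: ext_coord_linear.
rewrite theta_wedgeE theta_wedge_det; apply: eq_bigr => m _.
by rewrite ext_coord_wedge.
Qed.

Lemma theta_top (qn : (q.+2 <= n)%N) :
  theta (ext_basis K (top_set (leq_trans qn (leq_addr n n)))) = 0.
Proof.
apply/ffunP => T; rewrite theta_coord ffunE big1 // => m _.
apply/eqP; apply: contraT => /ext_coord_basis[_ /(_ ord0)].
by rewrite cons2_0 in_top_set /=; lia.
Qed.

(* For [y] in the kernel of [theta] and killed by the [E_ab] of the subalgebra
   [gl_n] with [a < b], the coordinate of [y] at [{m, n + m} :|: T] does not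
   depend on [m], whereas [theta y = 0] makes the sum over [m] of these
   coordinates vanish. *)
Lemma theta_ker_no_pair (y : extpow K (n + n) q.+2) : theta y = 0 ->
  (forall a b : 'I_n, (a < b)%N -> ext_act (sp_X K (lshift n a) (lshift n b)) y = 0) ->
  forall (S : psubset (n + n) q.+2) m, y S != 0 ->
  ~~ ((lshift n m \in val S) && (rshift n m \in val S)).
Proof.
move=> ty Xy S m yS; apply/negP => /andP[lS rS].
have cT : #|val S :\ lshift n m :\ rshift n m| == q.
  have := cardsD1 (lshift n m) (val S); rewrite lS (eqP (valP S)).
  have := cardsD1 (rshift n m) (val S :\ lshift n m).
  rewrite in_setD1 rS andbT eq_rlshift /= => ->.
  by rewrite !add1n => -[h]; apply/eqP/esym.
pose T : psubset (n + n) q := exist _ (val S :\ lshift n m :\ rshift n m) cT.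
pose F m' := ext_coord (cons2 (rshift n m') (lshift n m') (psub_elt T)) y.
pose good m' := (rshift n m' \notin val T) && (lshift n m' \notin val T).
have sumF : \sum_m' F m' = 0 by rewrite -theta_coord ty ffunE.
(* If [T] contains an index of the pair, the tuple repeats it. *)
have F0 m' : ~~ good m' -> F m' = 0.
  move=> ng; apply/eqP; apply: contraNT ng => /ext_coord_inj c_inj.
  have out j x : cons2 (rshift n m') (lshift n m') (psub_elt T) j = x ->
      (forall k, j != lift ord0 (lift ord0 k)) -> x \notin val T.
    move=> jx jn; apply/negP => /psub_elt_surj[k kx].
    have := jn k; rewrite (_ : j = lift ord0 (lift ord0 k)) ?eqxx //.
    by apply: c_inj; rewrite jx -kx; exact: (esym (cons2_2 _ _ _ _)).
  apply/andP; split; [apply: (out ord0)|apply: (out (lift ord0 ord0))];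
    by rewrite ?cons2_0 ?cons2_1 // => k; rewrite ?(inj_eq lift_inj) neq_lift.
have Flt (a b : 'I_n) : (a < b)%N -> good a -> good b -> F a = F b.
  move=> ab /andP[ra la] /andP[rb lb].
  have abn : a != b by rewrite -val_eqE /= ltn_eqF.
  (* At the tuple (n + b, a, T) the two terms of [sp_X] replace a by b and n + b by n + a, with
     opposite signs; the coordinate is F b - F a. *)
  have := congr1 (ext_coord (cons2 (rshift n b) (lshift n a) (psub_elt T))) (Xy a b ab).
  rewrite [RHS]linear0 ext_coord_act !big_ord_recl [X in _ + (_ + X)]big1 ?addr0; last first.
    move=> k _; rewrite cons2_2 big1 // => x _; rewrite /sp_X !mxE !sp_conjl.
    have -> : (psub_elt T k == lshift n a) = false.
      by apply: contraNF la => /eqP <-; exact: psub_elt_mem.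
    have -> : (psub_elt T k == rshift n b) = false.
      by apply: contraNF rb => /eqP <-; exact: psub_elt_mem.
    by rewrite mulr0 subrr mul0r.
  rewrite cons2_0 cons2_1 (bigD1 (rshift n a)) //= big1 ?addr0; last first.
    move=> x /negPf xa; rewrite /sp_X !mxE !sp_conjl xa eq_rlshift andbF.
    by rewrite mulr0 subrr mul0r.
  rewrite (bigD1 (lshift n b)) //= big1 ?addr0; last first.
    move=> x /negPf xb; rewrite /sp_X !mxE !sp_conjl xb eq_lrshift andbF.
    by rewrite mulr0 subrr mul0r.
  rewrite upd_cons2_0 upd_cons2_1 /sp_X !mxE !sp_conjl !sp_signl !eqxx.
  rewrite !(eq_rlshift, eq_lrshift) /= !(mulr1, mulr0) sub0r subr0 mulN1r mul1r.
  by rewrite addrC => /eqP; rewrite subr_eq0 => /eqP.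
have gm : good m by rewrite /good /= !inE !eqxx andbF.
have FE m' : F m' = F m * (good m')%:R.
  case: (boolP (good m')) => g; last by rewrite mulr0 F0.
  rewrite mulr1; case: (ltngtP m m') => [mm'|m'm|/val_inj -> //].
    by rewrite (Flt m m').
  by rewrite (Flt m' m).
have Fm : F m != 0.
  have [b E] : exists b : bool, forall w : extpow K (n + n) q.+2,
      ext_coord (cons2 (rshift n m) (lshift n m) (psub_elt T)) w = (-1) ^+ b * w S.
    apply: ext_coord_image => [i j|j].
      case: (ord2P i) => [->|->|[k ->]]; case: (ord2P j) => [->|->|[k' ->]];
        rewrite ?(cons2_0, cons2_1, cons2_2) // => /eqP; rewrite ?eq_rlshift ?eq_lrshift //.
      - by move=> /eqP E; have := psub_elt_mem T k'; rewrite -E !inE eqxx.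
      - by move=> /eqP E; have := psub_elt_mem T k'; rewrite -E !inE eqxx andbF.
      - by move=> /eqP E; have := psub_elt_mem T k; rewrite E !inE eqxx.
      - by move=> /eqP E; have := psub_elt_mem T k; rewrite E !inE eqxx andbF.
      - by move=> /eqP/psub_elt_inj ->.
    case: (ord2P j) => [->|->|[k ->]]; rewrite ?(cons2_0, cons2_1, cons2_2) //.
    by have := psub_elt_mem T k; rewrite !inE => /and3P[].
  by rewrite /F E mulf_neq0 // signr_eq0.
(* The sum is F m times the number of good indices, which is positive as m is good. *)
move: sumF; rewrite (eq_bigr _ (fun m' _ => FE m')) -mulr_sumr => /eqP.
rewrite mulf_eq0 (negPf Fm) /= (bigD1 m) //= gm gt_eqF //.
by rewrite ltr_wpDr ?ltr01 //; apply: sumr_ge0 => i _; exact: ler0n.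
Qed.

End Theta.
End SPModels.

Section SPIrreducible.
Variable K : numFieldType.

Lemma sp_eps_sum n (T : {set 'I_(n + n)}) (i : 'I_n) :
  \sum_(a in T) sp_eps i a = (lshift n i \in T)%:Z - (rshift n i \in T)%:Z.
Proof. by rewrite /sp_eps sumrB !sum_delta_in. Qed.

(** Both matrix units in [sp_X] raise the depth, and the first [p] indices are those of largest
    depth, so a member of the set can only be replaced by another member. *)
Lemma sp_X_basis n p (pn : (p <= n)%N) (a b : 'I_(n + n)) :
  0 < sp_depth a - sp_depth b ->
  ext_act (sp_X K a b) (ext_basis K (top_set (leq_trans pn (leq_addr n n)))) = 0.
Proof.
move=> ab; have abn : a != b by apply: contraTneq ab => ->; rewrite subrr.
have H (c d : 'I_(n + n)) : c != d -> 0 < sp_depth c - sp_depth d ->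
    ext_act (delta_mx c d : 'M[K]_(n + n))
      (ext_basis K (top_set (leq_trans pn (leq_addr n n)))) = 0.
  move=> cdn cd; apply: ext_act_delta_basis => //; rewrite !in_top_set.
  move: cd; case: (split_ordP c) => i ->; case: (split_ordP d) => j ->;
    rewrite ?(sp_depthl, sp_depthr) /sp_level /=;
    by have := ltn_ord i; have := ltn_ord j; lia.
rewrite /sp_X addrC -scaleNr ext_act_linearl !H ?scaler0 ?addr0 //.
  by apply: contra abn => /eqP/(inv_inj (@sp_conjK n)) ->.
by rewrite !sp_depth_conj; lia.
Qed.

Section ThetaModel.
Variables (n q : nat) (qn : (q.+2 <= n)%N).
Local Notation D := (sp_root_data K n).
Local Notation W := (subvs_of (theta_ker K n q)).
Let S0 := top_set (leq_trans qn (leq_addr n n)).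

Fact theta_top_mem : ext_basis K S0 \in theta_ker K n q.
Proof. by rewrite mem_theta_ker theta_top. Qed.

Definition theta_top_vec : W := Subvs theta_top_mem.

Lemma theta_top_neq0 : theta_top_vec != 0.
Proof.
apply/eqP => /(congr1 (fun w : W => val w S0)).
by rewrite /= !ffunE eqxx => /eqP; rewrite oner_eq0.
Qed.

Lemma val_theta_ker_act (A : 'M[K]_(n + n)) (w : W) : A \in mxlie_space (sp K n) ->
  val (theta_ker_rep K n q (mxelt (sp K n) A) w) = ext_act A (val w).
Proof. by move=> Asp; rewrite -[LHS]/(ext_act (val (mxelt (sp K n) A)) (val w)) mxeltK. Qed.

Lemma theta_ker_rank1 (u : 'cV[K]_(n + n)) (w : W) :
  theta_ker_rep K n q (mxelt (sp K n) (u *m (symbar u)^T))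
    (theta_ker_rep K n q (mxelt (sp K n) (u *m (symbar u)^T)) w) = 0.
Proof.
apply: val_inj; rewrite !val_theta_ker_act ?sp_rank1_mem //.
by rewrite ext_act_rank1 sp_trace0 scale0r.
Qed.

Lemma theta_ker_hw : is_hw (D := D) (theta_ker_rep K n q)
  (fun i : 'I_n => (i < q.+2)%N%:Z) theta_top_vec.
Proof.
split=> [i|[a b]].
  apply: val_inj; rewrite val_theta_ker_act ?sp_cartan_mem // ext_basis_weight.
  rewrite sp_eps_sum !in_top_set /= [X in _ - X](_ : _ = 0) ?subr0 //.
  by rewrite ltnNge (leq_trans qn) ?leq_addr.
rewrite /height [X in 0 < X]/= sp_height => ab.
by apply: val_inj; rewrite val_theta_ker_act ?sp_X_mem // sp_X_basis.
Qed.

Lemma theta_ker_irreducible : irreducible_rep (theta_ker_rep K n q).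
Proof.
apply: (@form_irreducible K _ W (theta_ker_rep K n q)
  (fun x y => ext_form (val x) (val y)) (fun x => mxelt (sp K n) (val x)^T)
  theta_top_vec).
- by move=> a x x' y; exact: ext_form_linear.
- by move=> x y; exact: ext_formC.
- move=> x w y; rewrite val_theta_ker_act ?sp_tr ?(valP x) //.
  exact: ext_form_tr.
- exact: ext_form_basis.
move=> U Um Un0.
have [mu [w [Uw wn0 w_hw]]] := hw_exists (sp_tripotent theta_ker_rank1) Um Un0.
have [p [pn muE]] := sp_hw_shape theta_ker_rank1 wn0 w_hw.
have twist : theta (val w) = 0 by apply/eqP; rewrite -mem_theta_ker; exact: valP.
have Xw (a b : 'I_n) : (a < b)%N ->
    ext_act (sp_X K (lshift n a) (lshift n b)) (val w) = 0.
  move=> ab; rewrite -val_theta_ker_act ?sp_X_mem //.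
  have -> := w_hw.2 (lshift n a, lshift n b); first by [].
  rewrite /height [X in 0 < X]/= sp_height !sp_depthl /sp_level.
  by have := ltn_ord b; lia.
have supp T : val w T != 0 -> T = S0.
  move=> wT.
  have TE i : (lshift n i \in val T) = (i < p)%N /\ (rshift n i \in val T) = false.
    have := congr1 val (w_hw.1 i); rewrite val_theta_ker_act ?sp_cartan_mem //.
    move/weight_support/(_ wT); rewrite muE sp_eps_sum.
    (* The weight fixes only the difference of the two memberships; with the pair excluded, both are
       determined. *)
    have := theta_ker_no_pair twist Xw i wT.
    by case: (_ \in _) (_ \in _) (_ < _)%N => [] [] [].
  have pnn : (p <= n + n)%N by rewrite (leq_trans pn) ?leq_addr.
  suff TE' i : (i \in val T) = (i < p)%N.
    by case: (top_set_unique (leq_trans qn (leq_addr n n)) pnn TE').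
  case: (split_ordP i) => j ->; have [E1 E2] := TE j; first by rewrite E1.
  by rewrite E2 /= ltnNge (leq_trans pn) ?leq_addr.
have wE : w = val w S0 *: theta_top_vec.
  by apply: val_inj; rewrite /= -(ext_basis_span supp).
have [U0 Ul _] := Um.
have wS : val w S0 != 0.
  by apply: contraNneq wn0 => wS; rewrite wE wS scale0r.
have := Ul (val w S0)^-1 w 0 Uw U0.
by rewrite addr0 {2}wE scalerA mulVf // scale1r.
Qed.

End ThetaModel.

Section NatModel.
Variable n : nat.
Local Notation D := (sp_root_data K n.+1).
Let k0 : 'I_(n.+1 + n.+1) := lshift n.+1 ord0.

Lemma nat_cartan (w : 'cV[K]_(n.+1 + n.+1)) i k :
  nat_rep (sp K n.+1) (@cartan _ _ D i) w k 0 = (sp_eps i k)%:~R * w k 0.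
Proof. by rewrite /= /nat_act mxeltK ?sp_cartan_mem // mul_diag_mx !mxE. Qed.

Lemma sp_eps_k0 i : sp_eps i k0 = (i < 1)%N%:Z.
Proof.
rewrite /sp_eps /k0 eq_lshift eq_lrshift subr0 eq_sym -val_eqE /=.
by case: (nat_of_ord i).
Qed.

Lemma nat_rank1 (u : 'cV[K]_(n.+1 + n.+1)) w :
  nat_rep (sp K n.+1) (mxelt (sp K n.+1) (u *m (symbar u)^T))
    (nat_rep (sp K n.+1) (mxelt (sp K n.+1) (u *m (symbar u)^T)) w) = 0.
Proof.
rewrite /= /nat_act mxeltK ?sp_rank1_mem // mulmxA -[_ *m _ *m (_ *m _)]mulmxA.
rewrite [_^T *m (_ *m _)]mulmxA [_^T *m u]mx11_scalar -trace_mx11.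
by rewrite -mxtrace_mulC sp_trace0 mul_scalar_mx scale0r mulmx0 mul0mx.
Qed.

Lemma nat_hw : is_hw (D := D) (nat_rep (sp K n.+1))
  (fun i : 'I_n.+1 => (i < 1)%N%:Z) (delta_mx k0 0).
Proof.
split=> [i|[a b]].
  apply/colP => k; rewrite nat_cartan [RHS]mxE !mxE.
  by case: (k =P k0) => [->|_]; [rewrite sp_eps_k0|rewrite !mulr0].
rewrite /height [X in 0 < X]/= sp_height => ab.
have bk : b != k0.
  apply: contraTneq ab => ->; rewrite /k0 sp_depthl /sp_level.
  by have := sp_depth_le a; rewrite /=; lia.
have ak : sp_conj a != k0.
  apply: contraTneq ab => ak; have -> : a = rshift n.+1 ord0.
    by rewrite -[a]sp_conjK ak /k0 sp_conjl.
  by rewrite sp_depthr /sp_level; have := sp_depth_le b; rewrite /=; lia.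
rewrite /= /nat_act mxeltK ?sp_X_mem // mulmxBl -scalemxAl.
by rewrite !mul_delta_mx_0 // scaler0 subrr.
Qed.

Lemma nat_irreducible : irreducible_rep (nat_rep (sp K n.+1)).
Proof.
apply: (@form_irreducible K _ 'cV[K]_(n.+1 + n.+1) (nat_rep (sp K n.+1))
  (@Defs.form K _) (fun x => mxelt (sp K n.+1) (val x)^T) (delta_mx k0 0)).
- by move=> a x x' y; rewrite /Defs.form linearP /= mulmxDl -scalemxAl !mxE.
- by move=> x y; rewrite /Defs.form -[x^T *m y]trmxK trmx_mul trmxK [LHS]mxE.
- move=> x v w; rewrite /Defs.form /= /nat_act mxeltK ?sp_tr ?(valP x) //.
  by rewrite trmx_mul mulmxA.
- by rewrite /Defs.form trmx_delta mul_delta_mx mxE !eqxx oner_neq0.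
move=> U Um Un0.
have [mu [w [Uw wn0 w_hw]]] := hw_exists (sp_tripotent nat_rank1) Um Un0.
have [p [pn muE]] := sp_hw_shape nat_rank1 wn0 w_hw.
have supp k : w k 0 != 0 -> k = k0.
  move=> wk; have E i : sp_eps i k = (i < p)%N%:Z.
    have := congr1 (fun u : 'cV[K]_(n.+1 + n.+1) => u k 0) (w_hw.1 i).
    rewrite nat_cartan [RHS]mxE muE => /(mulIf wk) /eqP.
    by rewrite eqr_int => /eqP.
  case: (split_ordP k) E => j kE E; last first.
    by have := E j; rewrite kE /sp_eps eqxx eq_rlshift; case: (_ < _)%N.
  have := E j; have := E ord0.
  rewrite kE /sp_eps !eq_lshift !eq_lrshift eqxx /=.
  rewrite /k0; case: (j =P ord0) => [-> //|_].
  by case: (p) => [|p'] //=; case: (_ < _)%N.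
have [k wk] : exists k, w k 0 != 0.
  apply: contrapT => nw; case/eqP: wn0; apply/colP => k; rewrite mxE.
  by apply: contrapT => /eqP wk; apply: nw; exists k.
have wE : w = w k0 0 *: delta_mx k0 0.
  apply/colP => k'; rewrite !mxE; case: (eqVneq k' k0) => [->|kk]; first by rewrite mulr1.
  by rewrite mulr0; apply/eqP; apply: contraNT kk => /supp ->.
have [U0 Ul _] := Um; have wk0 : w k0 0 != 0 by rewrite -(supp k wk).
have := Ul (w k0 0)^-1 w 0 Uw U0.
by rewrite addr0 {2}wE scalerA mulVf // scale1r.
Qed.

End NatModel.
End SPIrreducible.

Section TrivialModel.
Variables (K : numFieldType) (L : lieAlgType K).

Lemma trivial_irreducible : irreducible_rep (trivial_rep L : rep L K^o).
Proof.
split; first by exists 1; exact: oner_neq0.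
move=> U [U0 Ul _]; case: (pselect (exists2 x, U x & x != 0)) => [[x Ux xn0]|nU].
  right; apply/seteqP; split=> // y _.
  have := Ul (y / x) x 0 Ux U0.
  by rewrite addr0 -[_ *: _]/(_ * _) divfK.
left; apply/seteqP; split=> x /=; last by move=> ->.
by move=> Ux; apply: contrapT => /eqP xn0; apply: nU; exists x.
Qed.

Lemma trivial_hw (D : root_data L) mu : (forall i, mu i = 0) ->
  is_hw (D := D) (trivial_rep L) mu (1 : K^o).
Proof. by move=> mu0; split=> // i; rewrite mu0 scale0r. Qed.

End TrivialModel.

(** * Classification *)

Section Annihilator.
Variables (K : fieldType) (L : lieAlgType K).

Lemma uea_ann_sqr (V : lmodType K) (rho : rep L V) (x : L) (c : K) :
  uea_ann rho (uea_gen x ^+ 2 - c *: uea_gen x) <->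
  forall v, rho x (rho x v) = c *: rho x v.
Proof.
have E v : uea_act rho (uea_gen x ^+ 2 - c *: uea_gen x) v =
    rho x (rho x v) - c *: rho x v.
  by rewrite expr2 -scaleNr uea_actD uea_actM uea_actZ !uea_act_gen scaleNr.
split=> h v; last by rewrite E h subrr.
by apply/eqP; rewrite -subr_eq0 -E h.
Qed.

Lemma rep_iso_sqr (V W : lmodType K) (rho : rep L V) (sigma : rep L W) x c :
  rep_iso rho sigma -> (forall w, sigma x (sigma x w) = c *: sigma x w) ->
  forall v, rho x (rho x v) = c *: rho x v.
Proof.
move=> [f f_bij fE] h v; apply: (bij_inj f_bij).
by rewrite linearZ !fE h.
Qed.

Lemma submodule_setT (V : lmodType K) (rho : rep L V) : submodule rho setT.
Proof. by []. Qed.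

End Annihilator.

Section Classification.
Variable K : numFieldType.

Lemma hw_exists_irreducible (L : lieAlgType K) (D : root_data L)
    (V : lmodType K) (rho : rep L V) :
  tripotent D rho -> irreducible_rep rho ->
  exists mu v, v != 0 /\ is_hw (D := D) rho mu v.
Proof.
move=> t [[v vn0] _].
have [|mu [w [_ wn0 w_hw]]] := hw_exists t (submodule_setT rho).
  by exists v.
by exists mu, w.
Qed.

Lemma hw_iso_trivial (L : lieAlgType K) (D : root_data L)
    (V : lmodType K) (rho : rep L V) mu v :
  irreducible_rep rho -> v != 0 -> is_hw (D := D) rho mu v ->
  (forall i, mu i = 0) -> is_trivial rho.
Proof.
move=> irr vn0 v_hw mu0.
exact: hw_iso irr (trivial_irreducible L) vn0 (oner_neq0 _) v_hw (trivial_hw mu0).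
Qed.

Lemma ext_basis_neq0 N p (S : psubset N p) : ext_basis K S != 0.
Proof.
apply/eqP => /(congr1 (fun w : extpow K N p => w S)).
by rewrite !ffunE eqxx => /eqP; rewrite oner_eq0.
Qed.

Lemma gl_classification N (V : lmodType K) (rho : rep (mxlie_alg (gl K N)) V) :
  irreducible_rep rho ->
  (forall (r u : 'cV[K]_N) v,
    rho (mxelt (gl K N) (r *m u^T)) (rho (mxelt (gl K N) (r *m u^T)) v) =
    \tr (r *m u^T) *: rho (mxelt (gl K N) (r *m u^T)) v) ->
  is_trivial rho \/ exists p, (1 <= p <= N)%N /\ rep_iso rho (ext_rep (gl K N) p).
Proof.
move=> irr rank1.
have [mu [v [vn0 v_hw]]] := hw_exists_irreducible (gl_tripotent rank1) irr.
have [p [pN muE]] := gl_hw_shape rank1 vn0 v_hw.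
case: (posnP p) => [p0|p0].
  by left; apply: hw_iso_trivial irr vn0 v_hw _ => i; rewrite muE p0.
right; exists p; rewrite p0; split=> //.
rewrite (funext muE : mu = _) in v_hw.
exact: hw_iso irr (gl_ext_irreducible K pN) vn0 (ext_basis_neq0 _) v_hw (gl_ext_hw K pN).
Qed.

Lemma sl_classification N (V : lmodType K) (rho : rep (mxlie_alg (sl K N.+1)) V) :
  irreducible_rep rho ->
  (forall (r u : 'cV[K]_N.+1) v, Defs.form u r = 0 ->
    rho (mxelt (sl K N.+1) (r *m u^T)) (rho (mxelt (sl K N.+1) (r *m u^T)) v) = 0) ->
  is_trivial rho \/ exists p, (1 <= p < N.+1)%N /\ rep_iso rho (ext_rep (sl K N.+1) p).
Proof.
move=> irr rank1.
have [mu [v [vn0 v_hw]]] := hw_exists_irreducible (sl_tripotent rank1) irr.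
have [p [/andP[p0 pN] muE]] := sl_hw_shape rank1 vn0 v_hw.
(* The case p = N.+1 is the top exterior power, trivial for sl: its normalized weight is zero. *)
move: (pN); rewrite leq_eqVlt => /predU1P[pE|p_lt].
  by left; apply: hw_iso_trivial irr vn0 v_hw _ => i; rewrite muE pE ltn_ord.
right; exists p; rewrite p0; split=> //.
rewrite (funext muE : mu = _) in v_hw.
exact: hw_iso irr (sl_ext_irreducible K pN p0) vn0 (ext_basis_neq0 _) v_hw (sl_ext_hw K pN p0).
Qed.

Lemma sp_classification n (V : lmodType K) (rho : rep (mxlie_alg (sp K n.+1)) V) :
  irreducible_rep rho ->
  (forall (u : 'cV[K]_(n.+1 + n.+1)) v,
    rho (mxelt (sp K n.+1) (u *m (symbar u)^T))
      (rho (mxelt (sp K n.+1) (u *m (symbar u)^T)) v) = 0) ->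
  is_trivial rho \/ (rep_iso rho (nat_rep (sp K n.+1)) \/
    exists q, (q.+2 <= n.+1)%N /\ rep_iso rho (theta_ker_rep K n.+1 q)).
Proof.
move=> irr rank1.
have [mu [v [vn0 v_hw]]] := hw_exists_irreducible (sp_tripotent rank1) irr.
have [p [pn muE]] := sp_hw_shape rank1 vn0 v_hw.
case: p pn muE => [|[|q]] pn muE.
- by left; apply: hw_iso_trivial irr vn0 v_hw _ => i; rewrite muE.
- right; left; rewrite (funext muE : mu = _) in v_hw.
  apply: hw_iso irr (nat_irreducible K n) vn0 _ v_hw (nat_hw K n).
  apply/eqP => /matrixP/(_ (lshift n.+1 ord0) 0); rewrite !mxE !eqxx => /eqP.
  by rewrite oner_eq0.
right; right; exists q; split=> //; rewrite (funext muE : mu = _) in v_hw.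
exact: hw_iso irr (theta_ker_irreducible K pn) vn0 (theta_top_neq0 K pn) v_hw (theta_ker_hw K pn).
Qed.

Lemma rank_one_classification (t : classical_type) (V : lmodType K)
    (rho : rep (mxlie_alg (classical_lie K t)) V) :
  classical_ok t -> irreducible_rep rho ->
  (forall x : mxlie_alg (classical_lie K t), rank_one (val x) ->
    forall v, rho x (rho x v) = \tr (val x) *: rho x v) <->
  (is_trivial rho \/ is_fundamental rho \/ is_determinant rho).
Proof.
(* Rank-one elements are non-zero by definition; since the relation is trivial at 0, this exception
   can be removed, and the vectors that define [A] may vary freely. *)
have rank1 (s : classical_type) (U : lmodType K)
    (sigma : rep (mxlie_alg (classical_lie K s)) U) A :
    (forall x : mxlie_alg (classical_lie K s), rank_one (val x) ->
      forall v, sigma x (sigma x v) = \tr (val x) *: sigma x v) ->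
    (A != 0 -> rank_one A) -> forall v,
    sigma (mxelt (classical_lie K s) A) (sigma (mxelt (classical_lie K s) A) v) =
    \tr A *: sigma (mxelt (classical_lie K s) A) v.
  move=> h AR v; have [->|An0] := eqVneq A 0.
    by rewrite /mxelt linear0 !rep0l scaler0.
  have Ag := rank_one_mem (AR An0).
  by rewrite h ?mxeltK //; exact: AR.
case: t rho => [N|[//|N]|[//|n]] rho /= ok irr; split.
- move=> h; have [|tr|[p [/andP[p1]]]] := gl_classification irr.
  + by move=> r u v; apply: (rank1 (TypeGL N)) => // n0; split=> //; exists r, u.
  + by left.
  rewrite leq_eqVlt => /predU1P[->|pN] iso; first by right; right.
  by right; left; exists p; rewrite p1.
- have ext p : rep_iso rho (ext_rep (gl K N) p) ->
      forall x : mxlie_alg (gl K N), rank_one (t := TypeGL N) (val x) ->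
      forall v, rho x (rho x v) = \tr (val x) *: rho x v.
    move=> iso x [_ [r [u xE]]]; apply: rep_iso_sqr iso _ => w.
    by rewrite -(val_mxelt x) xE ext_rep_rank1 ?memvf // mxeltK ?memvf.
  move=> [iso|[[p [_ iso]]|iso]]; [|exact: ext iso|exact: ext iso].
  by move=> x _; apply: rep_iso_sqr iso _ => w; rewrite /= /zero_act scaler0.
- move=> h; have [|tr|[p [pN iso]]] := sl_classification irr.
  + move=> r u v ur; have tr0 : \tr (r *m u^T) = 0 by rewrite mxtrace_mulC trace_mx11.
    have := rank1 (TypeSL N.+1) _ rho (r *m u^T) h; rewrite tr0 => ->.
      by rewrite scale0r.
    by move=> n0; split=> //; exists r, u.
  + by left.
  by right; left; exists p.
- move=> [iso|[[p [_ iso]]|//]] x.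
    by move=> _; apply: rep_iso_sqr iso _ => w; rewrite /= /zero_act scaler0.
  move=> [_ [r [u [_ xE]]]]; apply: rep_iso_sqr iso _ => w.
  have {}xE : val x = r *m u^T := xE.
  have xg : r *m u^T \in mxlie_space (sl K N.+1) by rewrite -xE; exact: valP.
  have -> : x = mxelt (sl K N.+1) (r *m u^T) by rewrite -xE val_mxelt.
  by rewrite ext_rep_rank1 //; congr (\tr _ *: _); exact/esym/mxeltK.
- move=> h; have [|tr|iso] := sp_classification irr.
  + move=> u v; have := rank1 (TypeSp n.+1) _ rho (u *m (symbar u)^T) h.
    rewrite sp_trace0 => ->; first by rewrite scale0r.
    by move=> n0; split=> //; exists u.
  + by left.
  by right; left.
- move=> [iso|[[iso|[q [qn iso]]]|//]] x.
  + by move=> _; apply: rep_iso_sqr iso _ => w; rewrite /= /zero_act scaler0.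
  + move=> [_ [u xE]]; apply: rep_iso_sqr iso _ => w.
    have {}xE : val x = u *m (symbar u)^T := xE.
    have tr0 : \tr (val x) = 0 by rewrite xE sp_trace0.
    rewrite [\tr _]tr0 scale0r -(val_mxelt x) xE; exact: nat_rank1.
  + move=> [_ [u xE]]; apply: rep_iso_sqr iso _ => w.
    have {}xE : val x = u *m (symbar u)^T := xE.
    have tr0 : \tr (val x) = 0 by rewrite xE sp_trace0.
    rewrite [\tr _]tr0 scale0r -(val_mxelt x) xE; exact: theta_ker_rank1.
Qed.

End Classification.

Theorem theorem1p1 (R : realType) (t : classical_type)
    (V : lmodType R[i]) (rho : rep (mxlie_alg (classical_lie R[i] t)) V) :
  classical_ok t -> irreducible_rep rho ->
  (forall x : mxlie_alg (classical_lie R[i] t), rank_one (val x) ->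
     uea_ann rho (uea_gen x ^+ 2 - \tr (val x) *: uea_gen x))
  <-> (is_trivial rho \/ is_fundamental rho \/ is_determinant rho).
Proof.
move=> ok irr; rewrite -(rank_one_classification ok irr).
by split=> h x /(h x)/uea_ann_sqr.
Qed.
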